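(* Let $G$ be an amenable locally compact group and let $X$ be a non-atomic Lebesgue measure space. Then the group $L_0(X,G)$ of all measurable maps from $X$ to $G$, equipped with the topology of convergence in measure, has the fixed point on compacta property (that is, is extremely amenable).
   Context: A topological group $G$ is amenable if every continuous affine action of $G$ on a (nonempty) convex compact set has a fixed point. A topological group has the fixed point on compacta property (equivalently, is called extremely amenable) if every continuous action of it on a (nonempty) compact space has a fixed point. A non-atomic Lebesgue measure space $X$ is a measure space isomorphic to $[0,1]$ with Lebesgue measure; denote its measure by $\mu$. $L_0(X,G)$ consists of the Borel-measurable maps $X\to G$, with pointwise multiplication, maps that are equal almost everywhere being identified. The topology of convergence in measure on $L_0(X,G)$ is the group topology whose basic neighbourhoods of the identity are the sets $$[V,\varepsilon]=\{g\in L_0(X,G) : \mu\{x\in X : g(x)\notin V\}<\varepsilon\},$$ where $V$ is a neighbourhood of the identity $e_G$ in $G$ and $\varepsilon>0$.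
   Formalization: L_0(X,G) is taken as the group generated by the Borel-measurable maps (modulo a.e. equality), since for some G that are not second countable these maps are not closed under products; when they are closed it is exactly the group of measurable maps. *)

(* Defs.v *)
From HB Require Import structures.
From mathcomp Require Import all_boot all_order all_algebra.
From mathcomp Require Import all_classical all_reals all_analysis.
From mathcomp Require Import measurable_realfun.

Set Implicit Arguments.
Unset Strict Implicit.
Unset Printing Implicit Defensive.

Import Order.TTheory GRing.Theory Num.Theory.
Import numFieldNormedType.Exports.

Local Open Scope classical_set_scope.
Local Open Scope ring_scope.

#[short(type="preTopologicalGroupType")]
HB.structure Definition PreTopologicalGroup := {G of Topological G & Group G}.

HB.mixin Record PreTopologicalGroup_isTopologicalGroup G
    of PreTopologicalGroup G := {
  mulg_continuous : continuous (fun x : G * G => (x.1 * x.2)%g) ;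
  invg_continuous : continuous (fun x : G => (x^-1)%g)
}.

#[short(type="topologicalGroupType")]
HB.structure Definition TopologicalGroup :=
  {G of PreTopologicalGroup G & PreTopologicalGroup_isTopologicalGroup G}.

(* The definitions below make sense for any topology on a group, so that they
   apply to L_0(X, G) without a prior proof that its operations are
   continuous. "Compact" includes "Hausdorff". *)
Section actions.
Context (G : preTopologicalGroupType).

Definition action_on (K : Type) (A : set K) (act : G -> K -> K) : Prop :=
  [/\ forall g x, A x -> A (act g x),
      forall x, A x -> act 1%g x = x
    & forall g h x, A x -> act (g * h)%g x = act g (act h x)].

Definition affine_on (R : realType) (V : lmodType R) (A : set V) (f : V -> V) :=
  forall (t : R) x y, 0 <= t <= 1 -> A x -> A y ->
    f (t *: x + (1 - t) *: y) = t *: f x + (1 - t) *: f y.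

(* tvsType includes local convexity. *)
Definition amenable (R : realType) : Prop :=
  forall (V : tvsType R) (K : set V) (act : G -> V -> V),
    hausdorff_space V -> K !=set0 -> compact K -> convex_set K ->
    action_on K act -> (forall g, affine_on K (act g)) ->
    {within [set: G] `*` K, continuous (fun p : G * V => act p.1 p.2)} ->
    exists2 x, K x & forall g, act g x = x.

Definition extremely_amenable : Prop :=
  forall (K : topologicalType) (act : G -> K -> K),
    hausdorff_space K -> [set: K] !=set0 -> compact [set: K] ->
    action_on [set: K] act ->
    continuous (fun p : G * K => act p.1 p.2) ->
    exists x, forall g, act g x = x.

End actions.

Section measure_spaces.
Local Open Scope ereal_scope.
Local Open Scope measure_scope.
Context (R : realType).

(* The measure spaces are compared through their completions: completed_algebra_gen
   is the completed sigma-algebra, on which the outer measure mu^* is the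
   completed measure. Hence X may carry its Borel sets or its Lebesgue
   measurable sets. *)
Definition isomorphic_mod0 d1 d2
    (X : measurableType d1) (Y : measurableType d2)
    (mu : {measure set X -> \bar R}) (nu : {measure set Y -> \bar R}) : Prop :=
  exists (X0 : set X) (Y0 : set Y) (phi : X -> Y),
    [/\ mu.-negligible (~` X0), nu.-negligible (~` Y0), set_bij X0 Y0 phi &
        forall B, B `<=` Y0 ->
          (completed_algebra_gen nu B <->
             completed_algebra_gen mu (X0 `&` phi @^-1` B)) /\
          (completed_algebra_gen nu B ->
             mu^* (X0 `&` phi @^-1` B) = nu^* B)].

Definition nonatomic_lebesgue_space d (X : measurableType d)
    (mu : {measure set X -> \bar R}) : Prop :=
  isomorphic_mod0 mu (mrestr (@lebesgue_measure R) (measurable_itv `[0%R, 1%R])).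

End measure_spaces.

Section L0_maps.
Context d (X : measurableType d) (G : topologicalGroupType).

Definition borel_measurable (f : X -> G) : Prop :=
  forall B : set G, <<s @open G >> B -> measurable (f @^-1` B).

(* For a group G that is not second countable, the Borel sigma-algebra of G * G
   may be larger than the product sigma-algebra, and the pointwise product of
   two Borel maps need not be Borel: if j embeds the double arrow space in
   (Z/2)^I, then x |-> (j (x+), 0) and x |-> (0, j ((1-x)+)) are Borel maps from
   [0, 1] to (Z/2)^I * (Z/2)^I, but their sum is not, because its image is
   discrete. The carrier of L_0(X, G) is therefore the group generated by the
   Borel maps; it consists of the Borel maps exactly when these are closed
   under pointwise products, e.g. when G is second countable
   (L0_carrierE). *)
Inductive L0_carrier : (X -> G) -> Prop :=
| L0_borel f : borel_measurable f -> L0_carrier f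
| L0_mul f g : L0_carrier f -> L0_carrier g ->
    L0_carrier (fun x => (f x * g x)%g).

Lemma borel_measurable_open (f : X -> G) :
  (forall U : set G, open U -> measurable (f @^-1` U)) -> borel_measurable f.
Proof.
move=> fo B; apply: (smallest_sub (C := sigma_algebra setT)
  (X := [set B : set G | measurable (f @^-1` B)])).
  split => /=.
  - by rewrite preimage_set0.
  - by move=> A mA; rewrite setTD preimage_setC; exact: measurableC.
  - by move=> F mF; rewrite preimage_bigcup; exact: bigcup_measurable.
by move=> U /fo.
Qed.

Lemma borel_measurable_preimage_open (f : X -> G) (U : set G) :
  borel_measurable f -> open U -> measurable (f @^-1` U).
Proof. by move=> mf oU; apply: mf; exact: sub_sigma_algebra. Qed.

Lemma borel_measurable_cst (a : G) : borel_measurable (fun=> a).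
Proof.
apply: borel_measurable_open => U _.
have [aU|aU] := pselect (U a).
  by rewrite (_ : _ @^-1` _ = setT)//; apply/seteqP; split.
by rewrite (_ : _ @^-1` _ = set0)//; apply/seteqP; split.
Qed.

Lemma borel_measurableV (f : X -> G) :
  borel_measurable f -> borel_measurable (fun x => ((f x)^-1)%g).
Proof.
move=> mf; apply: borel_measurable_open => U oU.
apply: (@borel_measurable_preimage_open f ((fun x : G => x^-1%g) @^-1` U)) => //.
by apply: open_comp => // x _; exact: invg_continuous.
Qed.

Lemma L0_carrier_cst1 : L0_carrier (fun=> 1%g).
Proof. exact/L0_borel/borel_measurable_cst. Qed.

Lemma L0_carrierV (f : X -> G) :
  L0_carrier f -> L0_carrier (fun x => ((f x)^-1)%g).
Proof.
elim=> [{}f mf|{}f g _ IHf _ IHg]; first exact/L0_borel/borel_measurableV.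
rewrite (_ : (fun x => _) = fun x => ((g x)^-1 * (f x)^-1)%g).
  exact: L0_mul.
by apply/funext => x; rewrite invgM.
Qed.

Lemma L0_carrierE (f : X -> G) : second_countable (T := G) ->
  L0_carrier f <-> borel_measurable f.
Proof.
move=> [D cD [oD bD]]; split; last exact: L0_borel.
elim=> // {}f g _ mf _ mg; apply: borel_measurable_open => U oU.
pose P := [set p : set G * set G | [/\ D p.1, D p.2 &
  forall a b, p.1 a -> p.2 b -> U (a * b)%g]].
rewrite (_ : _ @^-1` _ = \bigcup_(p in P) (f @^-1` p.1 `&` g @^-1` p.2)).
  rewrite bigcup_set_type; apply: countable_bigcupT_measurable.
    rewrite (eq_countable (card_setT P)); apply: (@sub_countable _ _ _ (D `*` D)).
      by apply: subset_card_le => p [].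
    exact: countableX.
  move=> [[A B] /= /set_mem[/= DA DB _]].
  by apply: measurableI; apply: borel_measurable_preimage_open => //; exact: oD.
apply/seteqP; split => [x Ux|x [[A B] [/= _ _ ABU] [/= Ax Bx]]]; last exact: ABU.
have [[V W] /= [nV nW] VWU] : nbhs (f x, g x)
    ((fun p : G * G => (p.1 * p.2)%g) @^-1` U).
  by apply: mulg_continuous; exact: open_nbhs_nbhs.
have [A [DA Af] AV] := bD _ _ nV; have [B [DB Bg] BW] := bD _ _ nW.
exists (A, B) => //; split => //= a b Aa Bb.
by apply: (VWU (a, b)); split; [exact: AV|exact: BW].
Qed.

Record L0_map := MkL0Map {L0_fun :> X -> G ; L0_funP : L0_carrier L0_fun}.

HB.instance Definition _ := gen_eqMixin L0_map.
HB.instance Definition _ := gen_choiceMixin L0_map.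

Definition L0_map_one := MkL0Map L0_carrier_cst1.
Definition L0_map_mul (f g : L0_map) := MkL0Map (L0_mul (L0_funP f) (L0_funP g)).
Definition L0_map_inv (f : L0_map) := MkL0Map (L0_carrierV (L0_funP f)).

End L0_maps.

Section L0.
Context d (X : measurableType d) (R : realType).
Variables (mu : {measure set X -> \bar R}) (G : topologicalGroupType).
Local Open Scope measure_scope.
Local Open Scope quotient_scope.

Definition L0_ae_eq (f g : L0_map X G) : bool :=
  `[< {ae mu, forall x, f x = g x} >].

Let L0_ae_eq_refl : reflexive L0_ae_eq.
Proof. by move=> f; apply/asboolP; apply: aeW. Qed.

Let L0_ae_eq_sym : symmetric L0_ae_eq.
Proof.
by move=> f g; apply/idP/idP => /asboolP fg; apply/asboolP;
  apply: filterS fg => x ->.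
Qed.

Let L0_ae_eq_trans : transitive L0_ae_eq.
Proof.
move=> g f h /asboolP fg /asboolP gh; apply/asboolP.
by apply: filterS2 fg gh => x -> ->.
Qed.

Canonical L0_ae_eq_canonical :=
  EquivRel L0_ae_eq L0_ae_eq_refl L0_ae_eq_sym L0_ae_eq_trans.

Definition L0 : Type := {eq_quot L0_ae_eq}.
HB.instance Definition _ := Choice.on L0.
HB.instance Definition _ := EqQuotient.on L0.

Definition L0_class (f : L0_map X G) : L0 := \pi_L0 f.

Lemma L0_classP (f g : L0_map X G) :
  L0_class f = L0_class g <-> {ae mu, forall x, f x = g x}.
Proof.
split=> [/eqP|fg]; first by rewrite eqmodE => /asboolP.
by apply/eqP; rewrite eqmodE; exact/asboolP.
Qed.

Lemma repr_L0_class (f : L0_map X G) :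
  {ae mu, forall x, repr (L0_class f) x = f x}.
Proof. by apply/L0_classP; rewrite /L0_class reprK. Qed.

Definition L0_oneg : L0 := L0_class (L0_map_one X G).
Definition L0_mulg (a b : L0) : L0 := L0_class (L0_map_mul (repr a) (repr b)).
Definition L0_invg (a : L0) : L0 := L0_class (L0_map_inv (repr a)).

Lemma L0_class_mul (f g : L0_map X G) :
  L0_mulg (L0_class f) (L0_class g) = L0_class (L0_map_mul f g).
Proof.
apply/L0_classP; apply: filterS2 (repr_L0_class f) (repr_L0_class g) => x /=.
by move=> -> ->.
Qed.

Lemma L0_class_inv (f : L0_map X G) :
  L0_invg (L0_class f) = L0_class (L0_map_inv f).
Proof. by apply/L0_classP; apply: filterS (repr_L0_class f) => x /= ->. Qed.

Lemma L0_classK (a : L0) : L0_class (repr a) = a.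
Proof. by rewrite /L0_class reprK. Qed.

Let L0_mulgA : associative L0_mulg.
Proof.
move=> a b c; rewrite -(L0_classK a) -(L0_classK b) -(L0_classK c).
rewrite !L0_class_mul; apply/L0_classP; apply: aeW => x /=.
by rewrite mulgA.
Qed.

Let L0_mul1g : left_id L0_oneg L0_mulg.
Proof.
move=> a; rewrite -(L0_classK a) L0_class_mul.
by apply/L0_classP; apply: aeW => x /=; rewrite mul1g.
Qed.

Let L0_mulg1 : right_id L0_oneg L0_mulg.
Proof.
move=> a; rewrite -(L0_classK a) L0_class_mul.
by apply/L0_classP; apply: aeW => x /=; rewrite mulg1.
Qed.

Let L0_mulVg : left_inverse L0_oneg L0_invg L0_mulg.
Proof.
move=> a; rewrite -(L0_classK a) L0_class_inv L0_class_mul.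
by apply/L0_classP; apply: aeW => x /=; rewrite mulVg.
Qed.

Let L0_mulgV : right_inverse L0_oneg L0_invg L0_mulg.
Proof.
move=> a; rewrite -(L0_classK a) L0_class_inv L0_class_mul.
by apply/L0_classP; apply: aeW => x /=; rewrite mulgV.
Qed.

HB.instance Definition _ :=
  isGroup.Build L0 L0_mulgA L0_mul1g L0_mulg1 L0_mulVg L0_mulgV.

(* [V, e]; the set need not be measurable for an arbitrary V, hence the outer
   measure, which agrees with mu on measurable sets. *)
Definition L0_basic (V : set G) (e : R) : set L0 :=
  [set a : L0 | (mu^* [set x | ~ V ((repr a : L0_map X G) x)] < e%:E)%E].

Definition L0_nbhs (a : L0) : set_system L0 :=
  [set A | exists V, nbhs (1%g : G) V /\
     exists2 e : R, 0 < e & forall b, L0_basic V e b -> A (a * b)%g].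

HB.instance Definition _ := hasNbhs.Build L0 L0_nbhs.

Lemma mu_ext_negligible (N : set X) : mu.-negligible N -> mu^* N = 0%E.
Proof.
move=> [A [mA A0 NA]]; apply/eqP; rewrite eq_le; apply/andP; split.
  rewrite -A0 -(measurable_mu_extE mu mA); exact: le_mu_ext.
by apply: mu_ext_ge0 => B; exact: measure_ge0.
Qed.

Lemma L0_basic_class (V : set G) (e : R) (f : L0_map X G) :
  L0_basic V e (L0_class f) <-> (mu^* [set x | ~ V (f x)] < e%:E)%E.
Proof.
suff -> : mu^* [set x | ~ V (f x)] =
          mu^* [set x | ~ V (repr (L0_class f) x)] by [].
have le (g h : L0_map X G) : {ae mu, forall x, g x = h x} ->
    (mu^* [set x | ~ V (g x)] <= mu^* [set x | ~ V (h x)])%E.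
  move=> gh; pose N := ~` [set x | g x = h x].
  rewrite -[leRHS]adde0 -(mu_ext_negligible (N := N) gh).
  apply: le_trans (outer_measureU2 _ _ _); apply: le_mu_ext => x /= nV.
  have [ghx|] := pselect (g x = h x); last by right.
  by left; rewrite -ghx.
by apply/eqP; rewrite eq_le !le//; first exact: repr_L0_class;
   apply: filterS (repr_L0_class f) => x ->.
Qed.

Let L0_basic1 (V : set G) (e : R) : nbhs (1%g : G) V -> 0 < e ->
  L0_basic V e 1%g.
Proof.
move=> V1 e0; apply/L0_basic_class; rewrite [X in mu^* X](_ : _ = set0).
  by rewrite mu_ext_negligible ?lte_fin//; exact: negligible_set0.
by apply/seteqP; split=> // x /=; apply; exact: nbhs_singleton.
Qed.

Let L0_nbhs_filter (a : L0) : ProperFilter (nbhs a).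
Proof.
split.
  by move=> [V [V1 [e e0 /(_ 1%g)]]]; apply; exact: L0_basic1.
split.
- by exists setT; split; [exact: filterT|exists 1].
- move=> A B [V [V1 [e e0 VA]]] [W [W1 [e' e'0 WB]]].
  exists (V `&` W); split; first exact: filterI.
  exists (Num.min e e'); first by rewrite lt_min e0.
  move=> b; rewrite /L0_basic /= => bVW; split; [apply: VA|apply: WB].
  + apply: le_lt_trans (lt_le_trans bVW _); last by rewrite lee_fin ge_min lexx.
    by apply: le_mu_ext => x /= nV [].
  + apply: le_lt_trans (lt_le_trans bVW _); last first.
      by rewrite lee_fin ge_min lexx orbT.
    by apply: le_mu_ext => x /= nV [].
- move=> A B AB [V [V1 [e e0 VA]]]; exists V; split => //; exists e => // b.
  by move=> /VA /AB.
Qed.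

Let L0_nbhs_singleton (a : L0) (A : set L0) : nbhs a A -> A a.
Proof.
move=> [V [V1 [e e0 VA]]]; rewrite -[a]mulg1; apply: VA; exact: L0_basic1.
Qed.

Let L0_nbhs_nbhs (a : L0) (A : set L0) : nbhs a A -> nbhs a (nbhs^~ A).
Proof.
move=> [V [V1 [e e0 VA]]].
have [[W W'] /= [W1 W'1] WV] : nbhs (1%g : G, 1%g : G)
    ((fun p : G * G => (p.1 * p.2)%g) @^-1` V).
  by apply: mulg_continuous; rewrite /= mul1g.
exists (W `&` W'); split; first exact: filterI.
exists (e / 2); first by rewrite divr_gt0.
move=> b bW; exists (W `&` W'); split; first exact: filterI.
exists (e / 2); first by rewrite divr_gt0.
move=> c cW; rewrite -mulgA; apply: VA; apply/L0_basic_class.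
rewrite [e]splitr EFinD; apply: le_lt_trans (lteD bW cW).
apply: le_trans (outer_measureU2 _ _ _); apply: le_mu_ext => x /= nV.
apply: contrapT => /not_orP[/contrapT[bx _] /contrapT[_ cx]]; apply: nV.
exact: (WV (repr b x, repr c x)).
Qed.

HB.instance Definition _ := Nbhs_isNbhsTopological.Build L0
  L0_nbhs_filter L0_nbhs_singleton L0_nbhs_nbhs.

End L0.

(* Main.v *)
From HB Require Import structures.
Require Import Defs.
From mathcomp Require Import all_boot all_order all_algebra.
From mathcomp Require Import all_classical all_reals all_analysis.
From mathcomp Require Import finmap ring lra measurable_realfun.
Set Implicit Arguments.
Unset Strict Implicit.
Unset Printing Implicit Defensive.
Import Order.TTheory GRing.Theory Num.Theory.
Import numFieldNormedType.Exports.
Local Open Scope classical_set_scope.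
Local Open Scope ring_scope.

(** Let L = L_0(X, G) act continuously on a nonempty compact Hausdorff space K.
    A point of K that is fixed by L is found by averaging over G, and by letting
    the averages concentrate.

    Amenability gives a mean M on the bounded uniformly continuous functions
    on G that is invariant under left translations
    (amenable_invariant_mean). Cut X into finitely many measurable pieces,
    indexed by I. The maps that are constant on every piece form a copy of
    G ^ I inside L, and iterating M over the coordinates gives a mean E on
    functions of h in G ^ I, invariant under G ^ I (product_mean). For a point
    k0 of K and a continuous f : K -> R, look at phi h = f (h k0). Since K is
    compact, phi hardly changes when h is changed on a set of small measure.
    Hence, up to a small error, phi is Lipschitz with some constant C for the
    Hamming distance weighted by the measures of the pieces (inf_conv_ge,
    inf_conv_lipschitz); here C depends on f but not on the pieces. The
    variance of such a function for E is at most the sum of the squares of its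
    oscillations in the single coordinates, that is, at most C ^ 2 times the
    measure of the largest piece. As X has no atoms, this is as small as one
    likes. So, given finitely many f and finitely many g in G ^ I, Chebyshev's
    inequality and the invariance of E yield an h for which the numbers phi h
    and phi (g h) are all close to the means E phi (concentrated_point): the
    point h k0 is almost fixed by the g (simple_almost_fixed). Compactness of K
    turns these points into one point fixed by all simple maps
    (simple_fixed_point).

    The stabilizer of that point is a closed subgroup of L, and L is generated
    by the Borel maps, so it remains to approximate a Borel map f : X -> G in
    measure by simple maps (simple_map_approximation). The difficulty is that G
    need not be separable. Let H be a sigma-compact open subgroup of G
    (sigma_compact_open_subgroup). Every union of cosets of H is open, so f
    modulo H is a map from X to a set, such that the preimages of all subsets
    are measurable. A Lebesgue space admits no such map with null fibers
    (null_fibers_union): otherwise one composes it with a distribution function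
    to obtain a real map g, for which again all preimages are measurable, and
    which pushes the measure below Lebesgue measure. Some rational translate of
    a transversal of R / Q has a preimage of positive measure; by Lusin's
    theorem, this preimage contains a compact set of positive measure on which
    g is continuous, and the image is a compact part of a transversal with
    positive Lebesgue measure, which is absurd since its rational translates
    are disjoint. Hence almost all of X is covered by countably many fibers of
    f modulo H, and so, for every neighborhood U of 1, by countably many
    preimages of translates of U; finitely many of them cover X up to a small
    measure. *)

(** * The locally convex space of real functions with pointwise convergence *)

Section pointwise_tvs.
Variables (R : realType) (I : choiceType).

(** The means on a space of functions I form a compact convex subset of this
    space, whose topology is the weak-* topology on functionals. *)
Definition ptws_fun : Type := prod_topology (fun _ : I => R^o).

HB.instance Definition _ := Uniform.copy ptws_fun (prod_topology (fun _ : I => R^o)).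
HB.instance Definition _ := GRing.Lmodule.copy ptws_fun (I -> R^o).

Lemma ptws_fun_cvgP (F : set_system ptws_fun) (f : ptws_fun) : Filter F ->
  F --> f <-> forall i, (g i : R^o) @[g --> F] --> (f i : R^o).
Proof.
move=> FF; split => [Ff i|Ff].
  apply: cvg_trans (@proj_continuous I (fun=> R^o) i f).
  by move=> A /=; exact: Ff.
apply/cvg_sup => i A [_ [[B oB <-] Bfi] BA].
apply: filterS BA _; apply: (Ff i B).
exact: open_nbhs_nbhs.
Qed.

Lemma ptws_fun_eval_continuous (i : I) : continuous (fun g : ptws_fun => g i : R^o).
Proof. by move=> f; exact: (@proj_continuous I (fun=> R^o) i f). Qed.

Lemma ptws_fun_add_continuous :
  continuous (fun z : ptws_fun * ptws_fun => z.1 + z.2).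
Proof.
move=> [f g].
apply/(@ptws_fun_cvgP ((fun z : ptws_fun * ptws_fun => z.1 + z.2) @ nbhs (f, g))) => i.
have H1 : (z.1 i : R^o) @[z --> nbhs (f, g)] --> (f i : R^o).
  exact: (@cvg_comp _ _ _ fst (fun h : ptws_fun => h i : R^o) _ _ _ cvg_fst (@ptws_fun_eval_continuous i f)).
have H2 : (z.2 i : R^o) @[z --> nbhs (f, g)] --> (g i : R^o).
  exact: (@cvg_comp _ _ _ snd (fun h : ptws_fun => h i : R^o) _ _ _ cvg_snd (@ptws_fun_eval_continuous i g)).
have H := @cvgD _ _ _ (nbhs (f, g)) (nbhs_filter _) _ _ _ _ H1 H2.
move=> A nA; exact: (H A nA).
Qed.

Lemma ptws_fun_scale_continuous :
  continuous (fun z : R^o * ptws_fun => z.1 *: z.2).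
Proof.
move=> [t g].
apply/(@ptws_fun_cvgP ((fun z : R^o * ptws_fun => z.1 *: z.2) @ nbhs (t, g))) => i.
have H2 : (z.2 i : R^o) @[z --> nbhs (t, g)] --> (g i : R^o).
  exact: (@cvg_comp _ _ _ snd (fun h : ptws_fun => h i : R^o) _ _ _ cvg_snd (@ptws_fun_eval_continuous i g)).
have H1 : (z.1 : R^o) @[z --> nbhs (t, g)] --> t by exact: cvg_fst.
have H := @cvgZ R R^o _ (nbhs (t, g)) (nbhs_filter _) _ _ _ _ H1 H2.
move=> A nA; exact: (H A nA).
Qed.

(** The boxes are convex and open, and form a basis of the topology. *)
Definition ptws_box (f : ptws_fun) (s : {fset I}) (e : R) : set ptws_fun :=
  [set g | forall i, i \in s -> `|f i - g i| < e].

Lemma ptws_box_open f s e : open (ptws_box f s e).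
Proof.
rewrite openE => g fg.
rewrite (_ : ptws_box f s e =
    \bigcap_(i in [set` s]) ((fun g : ptws_fun => g i : R^o) @^-1` ball (f i) e)).
  apply: filter_bigI => i si; apply: ptws_fun_eval_continuous.
  by apply: open_nbhs_nbhs; split; [exact: ball_open|rewrite -ball_normE; exact: fg].
by apply/seteqP; split => h /= hs i si; have := hs i si; rewrite -ball_normE.
Qed.

Lemma ptws_box_nbhs (f : ptws_fun) (A : set ptws_fun) : nbhs f A ->
  exists s, exists2 e : R, 0 < e & ptws_box f s e `<=` A.
Proof.
pose F : set_system ptws_fun := [set A : set ptws_fun | exists s,
  exists2 e : R, 0 < e & ptws_box f s e `<=` A].
(* The neighborhood filter is the coarsest one for which all evaluations
   converge, so it suffices that they converge along the filter of boxes. *)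
suff : F --> f by move=> + nA => /(_ A nA).
have FF : Filter F.
  split.
  - by exists fset0, 1.
  - move=> P Q [s [e e0 sP]] [t [e' e'0 tQ]].
    exists (s `|` t)%fset, (Num.min e e'); first by rewrite lt_min e0.
    move=> g gst; split; [apply: sP|apply: tQ] => i si.
      by have := gst i; rewrite in_fsetU si lt_min => /(_ isT)/andP[].
    by have := gst i; rewrite in_fsetU si orbT lt_min => /(_ isT)/andP[].
  - move=> P Q PQ [s [e e0 sP]]; exists s, e => //; exact: subset_trans PQ.
apply/ptws_fun_cvgP => i A'; rewrite -nbhs_ballE => -[e /= e0 eA].
exists [fset i]%fset, e => //.
move=> g gi; apply: eA; rewrite -ball_normE; apply: gi; exact: fset11.
Qed.

Lemma ptws_fun_locally_convex :
  exists2 B : set_system ptws_fun, (forall b, b \in B -> convex_set b) & basis B.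
Proof.
exists [set B | open B /\ convex_set (B : set (convex_lmodType ptws_fun))].
  by move=> B /set_mem[].
split => [B []//|f A /ptws_box_nbhs[s [e e0 sA]]].
exists (ptws_box f s e) => //; split; last by move=> i _; rewrite subrr normr0.
split; first exact: ptws_box_open.
move=> g h l /set_mem gs /set_mem hs; apply/mem_set => i si.
have {gs hs} [gi hi] := (gs i si, hs i si).
have -> : (conv l g h : ptws_fun) i = l%:num * g i + (1 - l%:num) * h i by [].
rewrite (_ : f i - _ = l%:num * (f i - g i) + (1 - l%:num) * (f i - h i)); last by ring.
have l0 : 0 <= l%:num by [].
have l1 : 0 <= 1 - l%:num by rewrite subr_ge0.
rewrite (le_lt_trans (ler_normD _ _))// !normrM (ger0_norm l0) (ger0_norm l1).
have [->|ln0] := eqVneq (l%:num) 0; first by rewrite mul0r add0r subr0 mul1r.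
have lp : 0 < l%:num by rewrite lt_neqAle eq_sym ln0.
nra.
Qed.

HB.instance Definition _ := PreTopologicalNmodule_isTopologicalNmodule.Build
  ptws_fun ptws_fun_add_continuous.
HB.instance Definition _ := TopologicalNmodule_isTopologicalLmodule.Build
  R ptws_fun ptws_fun_scale_continuous.
HB.instance Definition _ := Uniform_isTvs.Build R ptws_fun ptws_fun_locally_convex.

End pointwise_tvs.

(** * Invariant means on an amenable group *)

Lemma mulg_cvg (G : topologicalGroupType) (T : Type) (F : set_system T)
    (FF : Filter F) (f g : T -> G) (a b : G) :
  f x @[x --> F] --> a -> g x @[x --> F] --> b ->
  (f x * g x)%g @[x --> F] --> (a * b)%g.
Proof.
move=> fa gb.
apply: (@continuous2_cvg _ _ _ _ F FF f g (fun x y => (x * y)%g) a b _ fa gb).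
exact: (@mulg_continuous G (a, b)).
Qed.

Section means.
Variables (R : realType) (G : topologicalGroupType).

(** Uniform continuity is for translations of the variable on the left. For such
    functions the translates phi (g * _) depend on g continuously for the
    uniform norm, which makes the action on the means jointly continuous. *)
Definition rucb (phi : G -> R) : Prop :=
  (exists B, forall x, `|phi x| <= B) /\
  (forall e, 0 < e -> \forall u \near (1%g : G), forall x, `|phi (u * x)%g - phi x| <= e).

Definition invariant_mean (M : (G -> R) -> R) : Prop :=
  [/\ forall phi psi, rucb phi -> rucb psi -> M (fun x => phi x + psi x) = M phi + M psi,
      forall t phi, rucb phi -> M (fun x => t * phi x) = t * M phi,
      forall l phi, rucb phi -> (forall x, l <= phi x) -> l <= M phi,
      forall l phi, rucb phi -> (forall x, phi x <= l) -> M phi <= l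
    & forall g phi, rucb phi -> M (fun x => phi (g * x)%g) = M phi].

Lemma rucb_translate g phi : rucb phi -> rucb (fun x => phi (g * x)%g).
Proof.
move=> [[B phiB] uphi]; split; first by exists B => x; exact: phiB.
move=> e e0.
have conjg_cont : (g * u * g^-1)%g @[u --> (1%g : G)] --> (1%g : G).
  rewrite -[X in _ --> X](mulgV g) -[X in (X * _)%g](mulg1 g).
  apply: mulg_cvg; last exact: cvg_cst.
  by apply: mulg_cvg; [exact: cvg_cst|exact: cvg_id].
apply: (@filterS _ (nbhs (1%g : G)) _ _ _ _ (conjg_cont _ (uphi e e0))) => u /= ue x.
by have := ue (g * x)%g; rewrite !mulgA mulgVK.
Qed.

Lemma rucbD phi psi : rucb phi -> rucb psi -> rucb (fun x => phi x + psi x).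
Proof.
move=> [[B phiB] uphi] [[C psiC] upsi]; split.
  exists (B + C) => x; apply: le_trans (ler_normD _ _) _; exact: lerD.
move=> e e0; have e2 : 0 < e / 2 by rewrite divr_gt0.
apply: filterS2 (uphi _ e2) (upsi _ e2) => u phiu psiu x.
rewrite opprD addrACA [leRHS]splitr; apply: le_trans (ler_normD _ _) _; exact: lerD.
Qed.

Lemma rucbZ t phi : rucb phi -> rucb (fun x => t * phi x).
Proof.
move=> [[B phiB] uphi]; split.
  by exists (`|t| * B) => x; rewrite normrM ler_wpM2l.
move=> e e0; have t0 : 0 < `|t| + 1 by rewrite ltr_wpDl.
have e2 : 0 < e / (`|t| + 1) by rewrite divr_gt0.
apply: filterS (uphi _ e2) => u phiu x; rewrite -mulrBr normrM.
apply: (@le_trans _ _ ((`|t| + 1) * (e / (`|t| + 1)))).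
  by apply: ler_pM => //; rewrite lerDl.
by rewrite mulrC divfK// gt_eqF.
Qed.

Lemma rucbM phi psi : rucb phi -> rucb psi -> rucb (fun x => phi x * psi x).
Proof.
move=> [[B phiB] uphi] [[C psiC] upsi]; split.
  by exists (B * C) => x; rewrite normrM ler_pM.
have B0 : 0 <= B by apply: le_trans (phiB 1%g).
have C0 : 0 <= C by apply: le_trans (psiC 1%g).
move=> e e0; have D0 : 0 < B + C + 1 by rewrite ltr_wpDl// addr_ge0.
have e2 : 0 < e / (B + C + 1) by rewrite divr_gt0.
apply: filterS2 (uphi _ e2) (upsi _ e2) => u phiu psiu x.
rewrite (_ : _ - _ = phi (u * x)%g * (psi (u * x)%g - psi x) +
   (phi (u * x)%g - phi x) * psi x); last by ring.
apply: le_trans (ler_normD _ _) _; rewrite !normrM.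
apply: (@le_trans _ _ (B * (e / (B + C + 1)) + (e / (B + C + 1)) * C)).
  by apply: lerD; apply: ler_pM.
rewrite [_ * C]mulrC -mulrDl mulrA ler_pdivrMr// mulrC ler_wpM2l ?ltW//.
by rewrite ltrDl.
Qed.

Lemma rucb_cst c : rucb (fun=> c).
Proof.
split; first by exists `|c|.
by move=> e e0; apply: nearW => u x; rewrite subrr normr0 ltW.
Qed.

Section existence.
(* A mean is a functional on the subtype of uniformly continuous functions. That
   subtype carries no linear structure, so linearity is stated for all triples
   and pairs of functions that are pointwise related. *)
Let I : choiceType := {classic {phi : G -> R | rucb phi}}.
Let V := ptws_fun R I.
Let ev (m : V) (phi : I) : R := m phi.

Let means : set V := [set m |
  [/\ forall a b c : I, (forall x, sval c x = sval a x + sval b x) -> ev m c = ev m a + ev m b,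
      forall t (a c : I), (forall x, sval c x = t * sval a x) -> ev m c = t * ev m a,
      forall l (a : I), (forall x, l <= sval a x) -> l <= ev m a
    & forall l (a : I), (forall x, sval a x <= l) -> ev m a <= l]].

Let tr (g : G) (a : I) : I := exist rucb _ (rucb_translate g (svalP a)).
Let act (g : G) (m : V) : V := fun a => m (tr g a).

Let trM g h a : tr h (tr g a) = tr (g * h)%g a.
Proof. by apply: eq_exist; apply/funext => x /=; rewrite mulgA. Qed.

Let tr1 a : tr 1%g a = a.
Proof. by case: a => a pa; apply: eq_exist; apply/funext => x /=; rewrite mul1g. Qed.

Let bnd (a : I) : R := projT1 (cid (proj1 (svalP a))).
Let bndP a x : `|sval a x| <= bnd a.
Proof. by rewrite /bnd; case: cid. Qed.

Let ev_cont a : continuous (fun m : V => ev m a : R^o).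
Proof. exact: ptws_fun_eval_continuous. Qed.

Let means_closed : closed means.
Proof.
rewrite (_ : means =
  (\bigcap_(p in [set p : I * I * I | forall x, sval p.2 x = sval p.1.1 x + sval p.1.2 x])
     (fun m : V => (ev m p.2 - ev m p.1.1 - ev m p.1.2 : R^o)) @^-1` [set 0]) `&`
  (\bigcap_(p in [set p : R * (I * I) | forall x, sval p.2.2 x = p.1 * sval p.2.1 x])
     (fun m : V => (ev m p.2.2 - p.1 * ev m p.2.1 : R^o)) @^-1` [set 0]) `&`
  (\bigcap_(p in [set p : R * I | forall x, p.1 <= sval p.2 x])
     (fun m : V => (ev m p.2 : R^o)) @^-1` [set x | p.1 <= x]) `&`
  (\bigcap_(p in [set p : R * I | forall x, sval p.2 x <= p.1])
     (fun m : V => (ev m p.2 : R^o)) @^-1` [set x | x <= p.1])); last first.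
  apply/seteqP; split => m /=.
    move=> [mD mZ ml mu]; split; first split; first split.
    - by move=> [[a b] c] /= /mD ->; rewrite addrAC addrK subrr.
    - by move=> [t [a c]] /= /mZ ->; rewrite subrr.
    - by move=> [l a] /= /ml.
    - by move=> [l a] /= /mu.
  move=> [[[mD mZ] ml] mu]; split.
  - move=> a b c abc; apply/eqP; rewrite -subr_eq0 opprD addrA; apply/eqP.
    exact: (mD (a, b, c)).
  - move=> t a c ac; apply/eqP; rewrite -subr_eq0; apply/eqP.
    exact: (mZ (t, (a, c))).
  - by move=> l a; exact: (ml (l, a)).
  - by move=> l a; exact: (mu (l, a)).
apply: closedI; first apply: closedI; first apply: closedI.
- apply: closed_bigI => p _; apply: closed_comp; last exact: closed_eq.
  move=> m _; pose evm a := @ev_cont a m.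
  have H := @cvgB R R^o V (nbhs m) (nbhs_filter _) _ _ _ _
    (@cvgB R R^o V (nbhs m) (nbhs_filter _) _ _ _ _ (evm p.2) (evm p.1.1)) (evm p.1.2).
  by move=> A nA; exact: (H A nA).
- apply: closed_bigI => p _; apply: closed_comp; last exact: closed_eq.
  move=> m _; pose evm a := @ev_cont a m.
  have H := @cvgB R R^o V (nbhs m) (nbhs_filter _) _ _ _ _
    (evm p.2.2) (@cvgMl_tmp R V (nbhs m) (nbhs_filter _) _ p.1 _ (evm p.2.1)).
  by move=> A nA; exact: (H A nA).
- apply: closed_bigI => p _; apply: closed_comp; last exact: closed_ge.
  by move=> m _; exact: ev_cont.
- apply: closed_bigI => p _; apply: closed_comp; last exact: closed_le.
  by move=> m _; exact: ev_cont.
Qed.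

Let means_compact : compact means.
Proof.
apply: (@subclosed_compact _ _ [set m : V | forall a, `[- bnd a, bnd a]%classic (ev m a)]).
- exact: means_closed.
- by apply: (@tychonoff I (fun=> R^o) (fun a => `[- bnd a, bnd a]%classic)) => a; exact: segment_compact.
- move=> m [_ _ ml mu] a; rewrite /= in_itv/=; apply/andP; split.
    by apply: ml => x; have := bndP a x; rewrite ler_norml => /andP[].
  by apply: mu => x; have := bndP a x; rewrite ler_norml => /andP[].
Qed.

(* A function and its translates by nearby elements of G are uniformly close,
   and means do not increase uniform distances: this gives the joint continuity
   of the action. *)
Let means_lipschitz m (a b : I) e : means m ->
  (forall x, `|sval a x - sval b x| <= e) -> `|ev m a - ev m b| <= e.
Proof.
move=> [mD mZ ml mu] abe.
pose b' : I := exist rucb _ (rucbZ (-1) (svalP b)).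
pose c : I := exist rucb _ (rucbD (svalP a) (svalP b')).
have cE x : sval c x = sval a x - sval b x by rewrite /= mulN1r.
have -> : ev m a - ev m b = ev m c.
  by rewrite (mD a b' c (fun=> erefl)) (mZ (-1) b b' (fun=> erefl)) mulN1r.
rewrite ler_norml; apply/andP; split; [apply: ml|apply: mu] => x.
  by rewrite cE; have := abe x; rewrite ler_norml => /andP[].
by rewrite cE; have := abe x; rewrite ler_norml => /andP[].
Qed.

(** G acts on the compact convex set of means by translating their arguments, and
    a fixed point of this action is an invariant mean. *)
Lemma amenable_invariant_mean : amenable G R -> exists M, invariant_mean M.
Proof.
move=> /(_ V means act)[].
- exact: (@hausdorff_product I (fun=> R^o)).
- exists (fun a => sval a 1%g); split.
  + by move=> a b c /(_ 1%g).
  + by move=> t a c /(_ 1%g).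
  + by move=> l a /(_ 1%g).
  + by move=> l a /(_ 1%g).
- exact: means_compact.
- move=> m n t /set_mem[mD mZ ml mu] /set_mem[nD nZ nl nu]; apply/mem_set.
  have evE a : ev (conv t m n : V) a = t%:num * ev m a + (1 - t%:num) * ev n a by [].
  have t0 : 0 <= t%:num by [].
  have t1 : 0 <= 1 - t%:num by rewrite subr_ge0.
  split.
  + by move=> a b c abc; rewrite !evE (mD a b c abc) (nD a b c abc); ring.
  + by move=> s a c ac; rewrite !evE (mZ s a c ac) (nZ s a c ac); ring.
  + move=> l a la; rewrite evE.
    rewrite (_ : l = t%:num * l + (1 - t%:num) * l); last by ring.
    by apply: lerD; apply: ler_wpM2l => //; [exact: ml|exact: nl].
  + move=> l a la; rewrite evE.
    rewrite (_ : l = t%:num * l + (1 - t%:num) * l); last by ring.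
    by apply: lerD; apply: ler_wpM2l => //; [exact: mu|exact: nu].
- split.
  + move=> g m [mD mZ ml mu]; split.
    * by move=> a b c abc; apply: mD => x; exact: abc.
    * by move=> s a c ac; apply: mZ => x; exact: ac.
    * by move=> l a la; apply: ml => x; exact: la.
    * by move=> l a la; apply: mu => x; exact: la.
  + by move=> m _; apply/funext => a; rewrite /act tr1.
  + by move=> g h m _; apply/funext => a; rewrite /act trM.
- by move=> g t m n _ _ _.
- apply/subspace_continuousP => -[g0 m0] [_ mm0].
  apply/(@ptws_fun_cvgP _ _ ((fun p : G * V => act p.1 p.2) @ within ([set: G] `*` means) (nbhs (g0, m0)))) => a.
  apply/(@cvgrPdist_le R R) => e e0; have e2 : 0 < e / 2 by rewrite divr_gt0.
  have gg0 : (g * g0^-1)%g @[g --> g0] --> (1%g : G).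
    by rewrite -[X in _ --> X](mulgV g0); apply: mulg_cvg; [exact: cvg_id|exact: cvg_cst].
  have N1 : nbhs g0 [set g | forall x, `|sval (tr g a) x - sval (tr g0 a) x| <= e / 2].
    apply: (@filterS _ (nbhs g0) _ _ _ _ (gg0 _ ((proj2 (svalP a)) _ e2))) => g /= ge x.
    by have := ge (g0 * x)%g; rewrite mulgA mulgVK.
  have N2 : nbhs m0 [set m : V | `|ev m0 (tr g0 a) - ev m (tr g0 a)| <= e / 2].
    by have /(@cvgrPdist_le R R^o) := @ev_cont (tr g0 a) m0; exact.
  exists ([set g | forall x, `|sval (tr g a) x - sval (tr g0 a) x| <= e / 2],
          [set m : V | `|ev m0 (tr g0 a) - ev m (tr g0 a)| <= e / 2]) => //.
  move=> [g m] [/= Ng Nm] [_ mm].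
  rewrite [e]splitr; apply: le_trans (ler_distD (ev m (tr g0 a)) _ _) _.
  apply: lerD; first exact: Nm.
  apply: (@means_lipschitz m (tr g0 a) (tr g a) (e / 2) mm) => x.
  by rewrite distrC; exact: Ng.
move=> m [mD mZ ml mu] mfix.
(* The functional is extended by 0 to the functions that are not uniformly
   continuous. *)
pose M (phi : G -> R) := if pselect (rucb phi) is left p then ev m (exist _ phi p) else 0.
have ME phi (p : rucb phi) : M phi = ev m (exist _ phi p).
  by rewrite /M; case: pselect => // q; congr (ev m (exist _ _ _)); exact: Prop_irrelevance.
exists M; split.
- move=> phi psi p q; rewrite (ME _ p) (ME _ q) (ME _ (rucbD p q)).
  exact: mD.
- by move=> t phi p; rewrite (ME _ p) (ME _ (rucbZ t p)); exact: mZ.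
- by move=> l phi p lphi; rewrite (ME _ p); exact: ml.
- by move=> l phi p lphi; rewrite (ME _ p); exact: mu.
- move=> g phi p; rewrite (ME _ p) (ME _ (rucb_translate g p)).
  rewrite -[in RHS](mfix g); congr (ev m _); exact: eq_exist.
Qed.
End existence.
End means.

(** * Iterated means and their variance *)

Section mean_theory.
Variables (R : realType) (G : topologicalGroupType) (M : (G -> R) -> R).
Hypothesis meanM : invariant_mean M.

Lemma mean_lipschitz phi psi e : rucb phi -> rucb psi ->
  (forall x, `|phi x - psi x| <= e) -> `|M phi - M psi| <= e.
Proof.
move=> rphi rpsi le_e; have [MD MZ Ml Mu _] := meanM.
have rN := rucbZ (-1) rpsi; have rB := rucbD rphi rN.
have -> : M phi - M psi = M (fun x => phi x + -1 * psi x).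
  by rewrite (MD _ _ rphi rN) (MZ _ _ rpsi) mulN1r.
rewrite ler_norml; apply/andP; split; [apply: Ml|apply: Mu] => // x.
  by rewrite mulN1r; have := le_e x; rewrite ler_norml => /andP[].
by rewrite mulN1r; have := le_e x; rewrite ler_norml => /andP[].
Qed.

Lemma mean_le phi psi : rucb phi -> rucb psi ->
  (forall x, phi x <= psi x) -> M phi <= M psi.
Proof.
move=> rphi rpsi le_e; have [MD MZ Ml Mu _] := meanM.
have rN := rucbZ (-1) rpsi; have rB := rucbD rphi rN.
rewrite -subr_le0.
have -> : M phi - M psi = M (fun x => phi x + -1 * psi x).
  by rewrite (MD _ _ rphi rN) (MZ _ _ rpsi) mulN1r.
by apply: Mu => // x; rewrite mulN1r subr_le0.
Qed.

Lemma mean_cst c : M (fun=> c) = c.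
Proof.
have [_ _ Ml Mu _] := meanM.
by apply/eqP; rewrite eq_le Mu ?Ml//; exact: rucb_cst.
Qed.

(** A function of oscillation c stays within c of its mean, so that its variance,
    the mean of (phi - M phi) ^+ 2, is at most c ^+ 2. *)
Lemma mean_sqr phi c : rucb phi -> (forall x y, `|phi x - phi y| <= c) ->
  M (fun x => phi x ^+ 2) <= M phi ^+ 2 + c ^+ 2.
Proof.
move=> rphi osc; have [MD MZ Ml Mu _] := meanM.
have rphi2 : rucb (fun x => phi x ^+ 2) by exact: rucbM.
have dev x : `|phi x - M phi| <= c.
  rewrite -(mean_cst (phi x)); apply: mean_lipschitz => //; exact: rucb_cst.
pose m := M phi.
have rlin := rucbZ (- 2 * m) rphi.
have : M (fun x => phi x ^+ 2 + (- 2 * m) * phi x) <= c ^+ 2 - m ^+ 2.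
  apply: Mu => [|x]; first exact: rucbD.
  have : (phi x - m) ^+ 2 <= c ^+ 2.
    by rewrite -(real_normK (num_real (phi x - m))) lerXn2r ?nnegrE// (le_trans _ (dev x)).
  by move=> ?; lra.
rewrite (MD _ _ rphi2 rlin) (MZ _ _ rphi) -/m; move=> ?; lra.
Qed.

End mean_theory.

Section iterated_mean.
Variables (R : realType) (G : topologicalGroupType) (I : finType).
Implicit Types (phi psi : (I -> G) -> R) (h : I -> G).

Definition upd h (i : I) (x : G) : I -> G := fun j => if j == i then x else h j.

Definition pmulg (u h : I -> G) : I -> G := fun i => (u i * h i)%g.

(** The analogue of rucb on the group of functions I -> G, in a form that makes no
    reference to a topology on that group. *)
Definition rucbn phi : Prop :=
  (exists B, forall h, `|phi h| <= B) /\
  (forall e, 0 < e -> exists2 V, nbhs (1%g : G) V &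
     forall u h, (forall i, V (u i)) -> `|phi (pmulg u h) - phi h| <= e).

Definition coord_lipschitz phi (c : I -> R) : Prop :=
  forall h i x, `|phi (upd h i x) - phi h| <= c i.

Lemma updK h i : upd h i (h i) = h.
Proof. by apply/funext => j; rewrite /upd; case: eqP => // ->. Qed.

Lemma upd_upd h i x y : upd (upd h i x) i y = upd h i y.
Proof. by apply/funext => j; rewrite /upd; case: eqP. Qed.

Lemma updC h i j x y : i != j -> upd (upd h i x) j y = upd (upd h j y) i x.
Proof.
move=> ij; apply/funext => k; rewrite /upd.
by case: eqVneq => // ->; rewrite eq_sym (negbTE ij).
Qed.

Lemma upd_pmulg u h i x : upd (pmulg u h) i (u i * x)%g = pmulg u (upd h i x).
Proof. by apply/funext => j; rewrite /upd /pmulg; case: eqP => // ->. Qed.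

Lemma rucbn_section phi h i : rucbn phi -> rucb (fun x => phi (upd h i x)).
Proof.
move=> [[B phiB] uphi]; split; first by exists B.
move=> e e0; have [V V1 Ve] := uphi e e0.
apply: filterS (V1) => u Vu x.
pose w : I -> G := upd (fun=> 1%g) i u.
have -> : upd h i (u * x)%g = pmulg w (upd h i x).
  by apply/funext => j; rewrite /pmulg /w /upd; case: eqP => // _; rewrite mul1g.
by apply: Ve => j; rewrite /w /upd; case: eqP => // _; exact: nbhs_singleton.
Qed.

Lemma rucbnD phi psi : rucbn phi -> rucbn psi -> rucbn (fun h => phi h + psi h).
Proof.
move=> [[B phiB] uphi] [[C psiC] upsi]; split.
  exists (B + C) => x; apply: le_trans (ler_normD _ _) _; exact: lerD.
move=> e e0; have e2 : 0 < e / 2 by rewrite divr_gt0.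
have [V V1 Ve] := uphi _ e2; have [W W1 We] := upsi _ e2.
exists (V `&` W); first exact: filterI.
move=> u h VWu; rewrite opprD addrACA [leRHS]splitr.
apply: le_trans (ler_normD _ _) _; apply: lerD.
  by apply: Ve => i; have [] := VWu i.
by apply: We => i; have [] := VWu i.
Qed.

Lemma rucbn_cst c : rucbn (fun=> c).
Proof.
split; first by exists `|c|.
by move=> e e0; exists setT => [|u h _]; [exact: filterT|rewrite subrr normr0 ltW].
Qed.

Lemma rucbnM phi psi : rucbn phi -> rucbn psi -> rucbn (fun h => phi h * psi h).
Proof.
move=> [[B phiB] uphi] [[C psiC] upsi]; split.
  by exists (B * C) => x; rewrite normrM ler_pM.
pose h0 : I -> G := fun=> 1%g.
have B0 : 0 <= B by apply: le_trans (phiB h0).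
have C0 : 0 <= C by apply: le_trans (psiC h0).
move=> e e0; have D0 : 0 < B + C + 1 by rewrite ltr_wpDl// addr_ge0.
have e2 : 0 < e / (B + C + 1) by rewrite divr_gt0.
have [V V1 Ve] := uphi _ e2; have [W W1 We] := upsi _ e2.
exists (V `&` W); first exact: filterI.
move=> u h VWu.
rewrite (_ : _ - _ = phi (pmulg u h) * (psi (pmulg u h) - psi h) +
   (phi (pmulg u h) - phi h) * psi h); last by ring.
apply: le_trans (ler_normD _ _) _; rewrite !normrM.
apply: (@le_trans _ _ (B * (e / (B + C + 1)) + (e / (B + C + 1)) * C)).
  apply: lerD; apply: ler_pM => //; first by apply: We => i; have [] := VWu i.
  by apply: Ve => i; have [] := VWu i.
rewrite [_ * C]mulrC -mulrDl mulrA ler_pdivrMr// mulrC ler_wpM2l ?ltW//.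
by rewrite ltrDl.
Qed.

Lemma rucbn_translate g phi : rucbn phi -> rucbn (phi \o pmulg g).
Proof.
move=> [[B phiB] uphi]; split; first by exists B => h; exact: phiB.
move=> e e0; have [V V1 Ve] := uphi e e0.
pose W (i : I) := [set u : G | V (g i * u * (g i)^-1)%g].
have W1 i : nbhs (1%g : G) (W i).
  suff conjg_cont : (g i * u * (g i)^-1)%g @[u --> (1%g : G)] --> (1%g : G).
    exact: conjg_cont.
  rewrite -[X in _ --> X](mulgV (g i)) -[X in (X * _)%g](mulg1 (g i)).
  apply: mulg_cvg; last exact: cvg_cst.
  by apply: mulg_cvg; [exact: cvg_cst|exact: cvg_id].
(* The coordinates of u are conjugated by those of g, and I is finite. *)
exists [set u | forall i, W i u].
  have H := @filter_bigI _ _ [fset i | i in I]%fset W (nbhs (1%g : G)) (nbhs_filter _) (fun i _ => W1 i).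
  apply: filterS H => u Wu i.
  by apply: Wu; apply/imfsetP; exists i.
move=> u h Wu; rewrite /=.
have -> : pmulg g (pmulg u h) = pmulg (fun i => g i * u i * (g i)^-1)%g (pmulg g h).
  by apply/funext => i; rewrite /pmulg !mulgA mulgVK.
by apply: Ve => i; exact: Wu.
Qed.

Variable M : (G -> R) -> R.
Hypothesis meanM : invariant_mean M.

(** The conditional expectation given all coordinates but i. *)
Definition coord_mean (i : I) phi : (I -> G) -> R :=
  fun h => M (fun x => phi (upd h i x)).

Lemma rucbn_coord_mean i phi : rucbn phi -> rucbn (coord_mean i phi).
Proof.
move=> rphi; have [[B phiB] uphi] := rphi; have [_ _ Ml Mu Minv] := meanM; split.
  exists B => h; rewrite ler_norml; apply/andP; split;
    [apply: Ml|apply: Mu] => [|x||x]; try exact: rucbn_section.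
    by have := phiB (upd h i x); rewrite ler_norml => /andP[].
  by have := phiB (upd h i x); rewrite ler_norml => /andP[].
move=> e /uphi[V V1 Ve]; exists V => // u h Vu.
pose w := upd u i 1%g.
have -> : coord_mean i phi (pmulg u h) = M (fun x => phi (pmulg w (upd h i x))).
  congr M; apply/funext => x; congr phi; apply/funext => j.
  by rewrite /pmulg /w /upd; case: eqP => // _; rewrite mul1g.
apply: (mean_lipschitz meanM).
- rewrite (_ : (fun x => _) = fun x => phi (upd (pmulg w h) i x)).
    exact: rucbn_section.
  apply/funext => x; congr phi; apply/funext => j.
  by rewrite /pmulg /w /upd; case: eqP => // _; rewrite mul1g.
- exact: rucbn_section.
- move=> x; apply: Ve => j; rewrite /w /upd; case: eqP => // _; exact: nbhs_singleton.
Qed.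

(** Averaging over one coordinate does not increase the oscillation in the
    others, and removes the oscillation in that one. *)
Lemma coord_lipschitz_mean i phi c : rucbn phi ->
  coord_lipschitz phi c -> coord_lipschitz (coord_mean i phi) c.
Proof.
move=> rphi lphi h j x.
apply: (mean_lipschitz meanM); [exact: rucbn_section|exact: rucbn_section|move=> y].
have [->|ij] := eqVneq i j; last by rewrite updC 1?eq_sym.
by rewrite upd_upd subrr normr0; exact: le_trans (lphi h j 1%g).
Qed.

Definition iterated_mean (s : seq I) phi := foldr coord_mean phi s.

Lemma rucbn_iterated_mean s phi : rucbn phi -> rucbn (iterated_mean s phi).
Proof. by move=> rphi; elim: s => //= i s IHs; exact: rucbn_coord_mean. Qed.

Lemma coord_lipschitz_iterated s phi c : rucbn phi ->
  coord_lipschitz phi c -> coord_lipschitz (iterated_mean s phi) c.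
Proof.
move=> rphi lphi; elim: s => //= i s IHs.
by apply: coord_lipschitz_mean => //; exact: rucbn_iterated_mean.
Qed.

Lemma iterated_meanD s phi psi : rucbn phi -> rucbn psi ->
  iterated_mean s (fun h => phi h + psi h) =
  (fun h => iterated_mean s phi h + iterated_mean s psi h).
Proof.
move=> rphi rpsi; have [MD _ _ _ _] := meanM; elim: s => //= i s ->.
by apply/funext => h; rewrite /coord_mean MD//; apply: rucbn_section; exact: rucbn_iterated_mean.
Qed.

Lemma iterated_meanZ s t phi : rucbn phi ->
  iterated_mean s (fun h => t * phi h) = (fun h => t * iterated_mean s phi h).
Proof.
move=> rphi; have [_ MZ _ _ _] := meanM; elim: s => //= i s ->.
by apply/funext => h; rewrite /coord_mean MZ//; apply: rucbn_section; exact: rucbn_iterated_mean.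
Qed.

Lemma iterated_mean_ge s l phi h : rucbn phi -> (forall h, l <= phi h) ->
  l <= iterated_mean s phi h.
Proof.
move=> rphi lphi; have [_ _ Ml _ _] := meanM; elim: s h => //= i s IHs h.
by apply: Ml => //; apply: rucbn_section; exact: rucbn_iterated_mean.
Qed.

(** In particular the mean over all coordinates is a constant function. *)
Lemma iterated_mean_agree s phi h h' : (forall i, i \notin s -> h i = h' i) ->
  iterated_mean s phi h = iterated_mean s phi h'.
Proof.
elim: s h h' => [|i s IHs] h h' hh' /=; first by congr phi; apply/funext => i; exact: hh'.
congr M; apply/funext => x; apply: IHs => j js; rewrite /upd.
by case: eqP => // /eqP ji; apply: hh'; rewrite inE negb_or ji.
Qed.

Lemma iterated_mean_translate s g phi h : rucbn phi ->
  iterated_mean s (phi \o pmulg g) h = iterated_mean s phi (pmulg g h).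
Proof.
move=> rphi; have [_ _ _ _ Minv] := meanM; elim: s h => //= i s IHs h.
have rs := rucbn_section (pmulg g h) i (rucbn_iterated_mean s rphi).
rewrite /coord_mean -(Minv (g i) _ rs); congr M; apply/funext => x.
by rewrite IHs upd_pmulg.
Qed.

(** The bound of Efron and Stein. Each averaging step adds the variance in one
    coordinate, and the function obtained so far still oscillates by at most
    c i in the coordinate i. *)
Lemma iterated_mean_sqr s phi c h : rucbn phi -> coord_lipschitz phi c ->
  iterated_mean s (fun h => phi h ^+ 2) h <=
  iterated_mean s phi h ^+ 2 + \sum_(i <- s) c i ^+ 2.
Proof.
move=> rphi lphi; have rphi2 : rucbn (fun h => phi h ^+ 2) by exact: rucbnM.
elim: s h => [|i s IHs] h; first by rewrite big_nil addr0.
rewrite big_cons addrA /=.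
set psi := iterated_mean s phi.
have rpsi : rucbn psi by exact: rucbn_iterated_mean.
have [MD _ _ _ _] := meanM.
pose K := \sum_(j <- s) c j ^+ 2.
have rpsi2 : rucbn (fun h => psi h ^+ 2) by exact: rucbnM.
apply: (@le_trans _ _ (M (fun x => psi (upd h i x) ^+ 2 + K))).
  apply: (mean_le meanM) => //.
  - by apply: rucbn_section; exact: rucbn_iterated_mean.
  - by apply: (@rucbn_section (fun h => psi h ^+ 2 + K)); apply: rucbnD => //; exact: rucbn_cst.
rewrite MD; [|exact: (@rucbn_section (fun h => psi h ^+ 2))|exact: rucb_cst].
rewrite (mean_cst meanM) lerD2r; apply: (mean_sqr meanM) => [|x y].
  exact: rucbn_section.
by rewrite -(upd_upd h i y x); exact: coord_lipschitz_iterated.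
Qed.

End iterated_mean.

(** The mean plays the role of a product measure. Neither countable additivity
    nor a Fubini theorem is at hand, but the averages are always taken in the
    same order. *)
Lemma product_mean (R : realType) (G : topologicalGroupType) (I : finType)
    (M : (G -> R) -> R) : invariant_mean M ->
  exists E : ((I -> G) -> R) -> R,
  [/\ forall phi psi, rucbn phi -> rucbn psi ->
        E (fun h => phi h + psi h) = E phi + E psi,
      forall t phi, rucbn phi -> E (fun h => t * phi h) = t * E phi,
      forall l phi, rucbn phi -> (forall h, l <= phi h) -> l <= E phi,
      forall g phi, rucbn phi -> E (phi \o pmulg g) = E phi
    & forall phi c, rucbn phi -> coord_lipschitz phi c ->
        E (fun h => phi h ^+ 2) <= E phi ^+ 2 + \sum_i c i ^+ 2].
Proof.
move=> meanM.
exists (fun phi => iterated_mean M (index_enum I) phi (fun=> 1%g)); split.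
- by move=> phi psi rphi rpsi; rewrite iterated_meanD.
- by move=> t phi rphi; rewrite iterated_meanZ.
- by move=> l phi rphi lphi; exact: iterated_mean_ge.
- move=> g phi rphi; rewrite iterated_mean_translate//.
  by apply: iterated_mean_agree => i; rewrite mem_index_enum.
- by move=> phi c rphi lphi; exact: iterated_mean_sqr.
Qed.

(** * Lipschitz regularization and concentration *)

Section lipschitz_regularization.
Variables (R : realType) (G : topologicalGroupType) (I : finType).
Variable (p : I -> R).
Hypothesis p_ge0 : forall i, 0 <= p i.
Implicit Types (phi psi : (I -> G) -> R) (h : I -> G).

Definition hamming h h' : R := \sum_(i | h i != h' i) p i.

Lemma hamming_refl h : hamming h h = 0.
Proof. by rewrite /hamming big1// => i; rewrite eqxx. Qed.

Lemma hamming_ge0 h h' : 0 <= hamming h h'.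
Proof. exact: sumr_ge0. Qed.

Lemma hamming_upd h h' i x : hamming (upd h i x) h' <= hamming h h' + p i.
Proof.
rewrite /hamming big_mkcond [in leRHS]big_mkcond /=.
rewrite (bigD1 i)//= [in leRHS](bigD1 i)//= addrAC [leLHS]addrC.
rewrite [leRHS]addrC; apply: lerD.
  by apply: ler_sum => j ji; rewrite /upd (negbTE ji).
by case: ifP => _; case: ifP => _; rewrite ?lerDr ?add0r ?addr_ge0.
Qed.

Lemma hamming_pmulg u h h' : hamming (pmulg u h) (pmulg u h') = hamming h h'.
Proof.
rewrite /hamming; apply: eq_bigl => i; rewrite /pmulg.
by apply/negP/negP => ne; apply: contra_not ne => /eqP; [move=> ->|move=> /mulgI ->].
Qed.

(** The largest minorant of phi that is C-Lipschitz for the Hamming distance. *)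
Definition inf_conv C phi h : R := inf [set phi h' + C * hamming h h' | h' in setT].

Variables (phi : (I -> G) -> R) (B C : R).
Hypotheses (phiB : forall h, `|phi h| <= B) (C0 : 0 <= C).

Let lb h : has_inf [set phi h' + C * hamming h h' | h' in setT].
Proof.
split; first by exists (phi h + C * hamming h h), h.
exists (- B) => _ [h' _ <-]; rewrite -[- B]addr0; apply: lerD; last first.
  by rewrite mulr_ge0// hamming_ge0.
by have := phiB h'; rewrite ler_norml => /andP[].
Qed.

(* Each competitor for the infimum at h2 is matched, up to t, by one at h1. *)
Let inf_conv_compare h1 h2 t :
  (forall h', exists h'', phi h'' + C * hamming h1 h'' <= phi h' + C * hamming h2 h' + t) ->
  inf_conv C phi h1 <= inf_conv C phi h2 + t.
Proof.
move=> cmp; rewrite -lerBlDr; apply: lb_le_inf; first by have [] := lb h2.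
move=> _ [h' _ <-]; have [h'' le''] := cmp h'; rewrite lerBlDr.
apply: le_trans le''; apply: ge_inf; first by have [] := lb h1.
by exists h''.
Qed.

Lemma inf_conv_lipschitz : coord_lipschitz (inf_conv C phi) (fun i => C * p i).
Proof.
move=> h i x; rewrite ler_distl; apply/andP; split.
  rewrite lerBlDr; apply: inf_conv_compare => h'; exists h'.
  rewrite -addrA -mulrDr lerD2l ler_wpM2l//.
  by rewrite -{1}(updK h i) -{1}(upd_upd h i x (h i)); exact: hamming_upd.
apply: inf_conv_compare => h'; exists h'.
by rewrite -addrA -mulrDr lerD2l ler_wpM2l// hamming_upd.
Qed.

Lemma inf_conv_le h : inf_conv C phi h <= phi h.
Proof.
apply: ge_inf; first by have [] := lb h.
by exists h => //; rewrite hamming_refl mulr0 addr0.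
Qed.

(** A competitor h' at distance less than d has almost the value phi h; at
    distance at least d the penalty exceeds the total oscillation 2 * B of phi. *)
Lemma inf_conv_ge h (e d : R) : 0 <= e -> 2 * B <= C * d ->
  (forall h', hamming h h' < d -> `|phi h - phi h'| <= e) ->
  phi h - e <= inf_conv C phi h.
Proof.
move=> e0 Cd small; apply: lb_le_inf; first by have [] := lb h.
move=> _ [h' _ <-].
have Ch : 0 <= C * hamming h h' by rewrite mulr_ge0// hamming_ge0.
have [lt_d|le_d] := ltP (hamming h h') d.
  by have := small _ lt_d; rewrite ler_norml => /andP[_]; lra.
have : C * d <= C * hamming h h' by rewrite ler_wpM2l.
have := phiB h; have := phiB h'; rewrite !ler_norml => /andP[? ?] /andP[? ?].
by move=> ?; lra.
Qed.

(** The Hamming distance is invariant under translations, so the competitors for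
    h can be translated by u. *)
Lemma rucbn_inf_conv : rucbn phi -> rucbn (inf_conv C phi).
Proof.
move=> [_ uphi]; split.
  exists B => h; rewrite ler_norml; apply/andP; split.
    apply: lb_le_inf; first by have [] := lb h.
    move=> _ [h' _ <-]; have : 0 <= C * hamming h h' by rewrite mulr_ge0// hamming_ge0.
    by have := phiB h'; rewrite ler_norml => /andP[]; lra.
  by apply: le_trans (inf_conv_le h) _; have := phiB h; rewrite ler_norml => /andP[].
move=> e /uphi[V V1 Ve]; exists V => // u h Vu.
pose ui i := ((u i)^-1)%g.
have uK h' : pmulg u (pmulg ui h') = h'.
  by apply/funext => i; rewrite /pmulg /ui mulVKg.
rewrite ler_distl; apply/andP; split.
  rewrite lerBlDr; apply: inf_conv_compare => h'; exists (pmulg ui h').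
  have := Ve _ (pmulg ui h') Vu; rewrite uK ler_norml => /andP[? _].
  rewrite -(hamming_pmulg u h) uK; lra.
apply: inf_conv_compare => h'; exists (pmulg u h').
rewrite hamming_pmulg; have := Ve _ h' Vu; rewrite ler_norml => /andP[_ ?]; lra.
Qed.

End lipschitz_regularization.

Section almost_invariant_points.
Variables (R : realType) (G : topologicalGroupType) (I : finType).
Variable (M : (G -> R) -> R).
Hypothesis meanM : invariant_mean M.

(** Chebyshev's inequality, without a measure: the sum of the squared deviations
    has a small mean, hence takes a small value. By invariance, the function that sends h to psi j (pmulg (g j) h) has the same
    mean and the same variance as psi j. *)
Lemma concentrated_point (J : finType) (psi : J -> (I -> G) -> R)
    (g : J -> I -> G) (c : J -> I -> R) (e : R) :
  (forall j, rucbn (psi j)) -> (forall j, coord_lipschitz (psi j) (c j)) ->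
  \sum_j \sum_i c j i ^+ 2 < e ->
  exists h, forall j, (psi j (pmulg (g j) h) - psi j h) ^+ 2 <= 4 * e.
Proof.
move=> rpsi lpsi ce; have [E [ED EZ Ege Einv Esqr]] := product_mean I meanM.
have Ecst r : E (fun=> r) = r.
  have rc x := @rucbn_cst R G I x.
  apply/eqP; rewrite eq_le (Ege _ _ (rc r))// andbT.
  by rewrite -lerN2 -[leRHS]mulN1r -EZ//; apply: Ege => // h; rewrite mulN1r.
pose m j := E (psi j).
pose dev j h := (psi j h - m j) ^+ 2.
have rdev j : rucbn (dev j).
  have rB : rucbn (fun h => psi j h - m j) by apply: rucbnD => //; exact: rucbn_cst.
  exact: (rucbnM rB rB).
have Edev j : E (dev j) <= \sum_i c j i ^+ 2.
  have r1 : rucbn (fun h => psi j h ^+ 2) by exact: (rucbnM (rpsi j) (rpsi j)).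
  have r2 : rucbn (fun h => (- 2 * m j) * psi j h) by apply: rucbnM => //; exact: rucbn_cst.
  have -> : dev j = fun h => psi j h ^+ 2 + ((- 2 * m j) * psi j h + m j ^+ 2).
    by apply/funext => h; rewrite /dev; ring.
  rewrite ED//; last by apply: rucbnD => //; exact: rucbn_cst.
  rewrite ED//; last exact: rucbn_cst.
  rewrite EZ// Ecst; have := Esqr _ _ (rpsi j) (lpsi j); rewrite -/(m j); lra.
pose F h := \sum_j (dev j (pmulg (g j) h) + dev j h).
have rF (s : seq J) : rucbn (fun h => \sum_(j <- s) (dev j (pmulg (g j) h) + dev j h)) /\
    E (fun h => \sum_(j <- s) (dev j (pmulg (g j) h) + dev j h)) =
    \sum_(j <- s) (E (dev j) *+ 2).
  elim: s => [|j s [rs Es]].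
    split; first by under eq_fun do rewrite big_nil; exact: rucbn_cst.
    by under eq_fun do rewrite big_nil; rewrite Ecst big_nil.
  have rj : rucbn (fun h => dev j (pmulg (g j) h) + dev j h).
    by apply: rucbnD => //; exact: rucbn_translate.
  split; under eq_fun do rewrite big_cons; first exact: rucbnD.
  rewrite ED// Es big_cons; congr (_ + _).
  rewrite ED//; last exact: rucbn_translate.
  by rewrite mulr2n; congr (_ + _); exact: (Einv (g j) (dev j)).

have [rFn EF] := rF (index_enum J).
have [h Fh] : exists h, F h < 2 * e.
  apply: contrapT => /forallNP nF.
  have : 2 * e <= E F by apply: Ege => // h; rewrite leNgt; apply/negP; exact: nF.
  apply/negP; rewrite -ltNge EF.
  have -> : \sum_j (E (dev j) *+ 2) = 2 * \sum_j E (dev j).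
    by rewrite mulr_sumr; apply: eq_bigr => j _; rewrite mulr_natl.
  by rewrite ltr_pM2l//; apply: le_lt_trans ce; exact: ler_sum.
exists h => j.
have dev0 i k : 0 <= dev i k by exact: sqr_ge0.
have : dev j (pmulg (g j) h) + dev j h <= 2 * e.
  apply: le_trans (ltW Fh); rewrite /F (bigD1 j)//= lerDl.
  by apply: sumr_ge0 => k _; exact: addr_ge0.
(* (a - b) ^+ 2 <= 2 * (a ^+ 2 + b ^+ 2) for the deviations a and b of the two
   values from the mean m j. *)
have := sqr_ge0 ((psi j (pmulg (g j) h) - m j) + (psi j h - m j)).
rewrite /dev; nra.
Qed.

End almost_invariant_points.

(** * Simple maps inside the group of measurable maps *)

Section compact_actions.
Variables (R : realType) (L : preTopologicalGroupType) (K : topologicalType).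
Variable (act : L -> K -> K).
Hypotheses (actP : action_on [set: K] act)
  (act_cont : continuous (fun p : L * K => act p.1 p.2))
  (compactK : compact [set: K]).

Lemma continuous_compact_bounded (f : K -> R) : continuous f ->
  exists B, forall x, `|f x| <= B.
Proof.
move=> cf; have cR : compact (f @` [set: K]).
  by apply: continuous_compact => //; exact: continuous_subspaceT.
have [B [_ fB]] := compact_bounded (cR : compact (f @` [set: K] : set R^o)).
by exists (B + 1) => x; apply: (fB (B + 1)); [rewrite ltrDl|exists x].
Qed.

Lemma action_near1 (f : K -> R) (e : R) : continuous f -> 0 < e ->
  \forall u \near (1%g : L), forall x, `|f (act u x) - f x| <= e.
Proof.
move=> cf e0; have [_ act1 _] := actP.
have /compact_near_coveringP cov := compactK.
suff : \forall u \near (1%g : L), [set: K] `<=` (fun x => `|f (act u x) - f x| <= e).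
  by apply: filterS => u Ku x; exact: Ku.
apply: cov => x _.
have e2 : 0 < e / 2 by rewrite divr_gt0.
have c1 : \forall p \near ((1%g : L), x), `|f x - f (act p.1 p.2)| <= e / 2.
  have /cvgrPdist_le := cf (act 1%g x) => /(_ _ e2) fx.
  have := @act_cont (1%g, x) _ fx.
  by rewrite /= act1.
have c2 : \forall x' \near x, `|f x - f x'| <= e / 2.
  by have /cvgrPdist_le := cf x => /(_ _ e2).
have [[A B] /= [A1 Bx] AB] := c1.
exists (B `&` [set x' | `|f x - f x'| <= e / 2], A); first by split => //; exact: filterI.
move=> [x' u] [[Bx' x'e] Au] /=.
rewrite [e]splitr; apply: le_trans (ler_distD (f x) _ _) _.
by apply: lerD => //; rewrite distrC; exact: (AB (u, x')).
Qed.

End compact_actions.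

Section labelled_maps.
Variables (R : realType) (G : topologicalGroupType).
Variables (d : measure_display) (X : measurableType d).
Variable (mu : {measure set X -> \bar R}).
Hypothesis mufin : (mu setT <= 1)%E.

(** A finite measurable partition of X, some pieces of which may be empty. *)
Definition measurable_labels (I : finType) (l : X -> I) :=
  forall i, measurable (l @^-1` [set i]).

Lemma measurable_labels_preimage (I : finType) (l : X -> I) (A : set I) :
  measurable_labels l -> measurable (l @^-1` A).
Proof.
move=> ml; rewrite (_ : l @^-1` A = \bigcup_(i in A) (l @^-1` [set i])).
  by apply: fin_bigcup_measurable => // i _; exact: ml.
by apply/seteqP; split => [x Ax|x [i Ai /= lxi]]; [exists (l x)|rewrite /preimage/= lxi].
Qed.

Lemma labelled_carrier (I : finType) (l : X -> I) (h : I -> G) :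
  measurable_labels l -> L0_carrier (h \o l).
Proof.
move=> ml; apply: L0_borel; apply: borel_measurable_open => U _.
by rewrite comp_preimage; exact: measurable_labels_preimage.
Qed.

Definition simple_map (s : X -> G) : Prop :=
  exists (I : finType) (l : X -> I) (c : I -> G), measurable_labels l /\ s = c \o l.

Section labels.
Variables (I : finType) (l : X -> I).
Hypothesis ml : measurable_labels l.

Definition labelled (h : I -> G) : L0 mu G := L0_class mu (MkL0Map (labelled_carrier h ml)).

Definition label_weight (i : I) : R := fine (mu (l @^-1` [set i])).

Lemma labelledM u h : labelled (pmulg u h) = (labelled u * labelled h)%g.
Proof.
rewrite /labelled; rewrite [RHS]L0_class_mul; congr (L0_class mu _).
by rewrite /L0_map_mul /=; congr MkL0Map; exact: Prop_irrelevance.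
Qed.

Lemma label_weightE i : (label_weight i)%:E = mu (l @^-1` [set i]).
Proof.
rewrite /label_weight fineK// ge0_fin_numE//; apply: le_lt_trans (ltry 1).
by apply: le_trans mufin; apply: le_measure => //; apply/mem_set => //; exact: ml.
Qed.

Lemma label_weight_ge0 i : 0 <= label_weight i.
Proof. exact: fine_ge0. Qed.

Lemma label_measure_sum (P : pred I) :
  mu (l @^-1` [set i | P i]) = (\sum_(i | P i) label_weight i)%:E.
Proof.
rewrite -big_filter.
have : [set i | P i] = [set i | i \in [seq i <- index_enum I | P i]].
  by apply/seteqP; split => i /=; rewrite mem_filter mem_index_enum andbT.
have : uniq [seq i <- index_enum I | P i] by rewrite filter_uniq// index_enum_uniq.
move: [seq i <- index_enum I | P i] => s us ->.
elim: s us => [_|i s IHs /= /andP[nis us]].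
  rewrite big_nil (_ : [set i | _] = set0) ?preimage_set0 ?measure0//.
  by apply/seteqP; split.
rewrite big_cons EFinD label_weightE -IHs// -measureU//.
- congr (mu _); apply/seteqP; split => x /=; rewrite inE.
    by case/orP => [/eqP|]; [left|right].
  by case=> [->|->]; rewrite ?eqxx ?orbT.
- exact: measurable_labels_preimage.
- by apply/seteqP; split => // x [/= ->]; rewrite (negbTE nis).
Qed.

(** A map that differs from 1 on a set of small measure only is close to 1. *)
Lemma labelled_basic (V : set G) (e : R) (u : I -> G) : nbhs (1%g : G) V ->
  \sum_(i | u i != 1%g) label_weight i < e -> L0_basic V e (labelled u).
Proof.
move=> V1 ue; apply/L0_basic_class; apply: le_lt_trans (_ : (_ <= (\sum_(i | u i != 1%g) label_weight i)%:E)%E) _; last by rewrite lte_fin.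
rewrite -label_measure_sum -measurable_mu_extE; last exact: measurable_labels_preimage.
apply: le_mu_ext => x /= nV; apply/eqP => ux; apply: nV; rewrite ux.
exact: nbhs_singleton.
Qed.

(** A map all of whose values are close to 1 is close to 1. *)
Lemma labelled_basicV (V : set G) (e : R) (u : I -> G) : 0 < e ->
  (forall i, V (u i)) -> L0_basic V e (labelled u).
Proof.
move=> e0 Vu; apply/L0_basic_class; rewrite (_ : [set _ | _] = set0).
  by rewrite mu_ext_negligible ?lte_fin//; exact: negligible_set0.
by apply/seteqP; split => // x /=; apply; exact: Vu.
Qed.

End labels.
End labelled_maps.

(** * Points almost fixed by finitely many simple maps *)

Section simple_maps_fixed_point.
Variables (R : realType) (G : topologicalGroupType).
Variables (d : measure_display) (X : measurableType d).
Variable (mu : {measure set X -> \bar R}).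
Hypothesis mufin : (mu setT <= 1)%E.
Hypothesis small_labels : forall e : R, 0 < e -> exists (I : finType) (l : X -> I),
  measurable_labels l /\ forall i, (mu (l @^-1` [set i]) <= e%:E)%E.
Variable (M : (G -> R) -> R).
Hypothesis meanM : invariant_mean M.

(** The common refinement of the partitions attached to the maps s j and of a
    partition into small pieces. *)
Lemma common_labels (J : finType) (s : J -> X -> G) (e : R) :
  (forall j, simple_map (s j)) -> 0 < e ->
  exists (I : finType) (l : X -> I) (g : J -> I -> G),
    [/\ measurable_labels l, forall i, (mu (l @^-1` [set i]) <= e%:E)%E &
        forall j, s j = g j \o l].
Proof.
move=> simple_s /small_labels[I0 [l0 [ml0 l0e]]].
pose Ij j : finType := projT1 (cid (simple_s j)).
have simple_sj j : exists l : X -> Ij j, exists2 c : Ij j -> G,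
    measurable_labels l & s j = c \o l.
  by rewrite /Ij; case: cid => I /= [l [c [ml ->]]]; exists l, c.
pose lj j := projT1 (cid (simple_sj j)).
have lcj j : exists2 c : Ij j -> G, measurable_labels (lj j) & s j = c \o lj j.
  by rewrite /lj; case: cid.
pose cj j := projT1 (cid2 (lcj j)).
have [mlj sj] : (forall j, measurable_labels (lj j)) /\ (forall j, s j = cj j \o lj j).
  by split=> j; rewrite /cj; case: (cid2 (lcj j)).
pose l x : {dffun forall j, Ij j} * I0 := ([ffun j => lj j x], l0 x).
have lE i : l @^-1` [set i] =
    \bigcap_(j in [set: J]) (lj j @^-1` [set i.1 j]) `&` l0 @^-1` [set i.2].
  apply/seteqP; split => x /=.
    by move=> <-; split => // j _; rewrite /l /= ffunE.
  case: i => i1 i2 /= [xi1 <-]; congr pair.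
  by apply/ffunP => j; rewrite ffunE xi1.
exists ({dffun forall j, Ij j} * I0)%type, l, (fun j (i : {dffun forall j, Ij j} * I0) => cj j (i.1 j)).
have ml : measurable_labels l.
  move=> i; rewrite lE; apply: measurableI; last exact: ml0.
  by apply: fin_bigcap_measurable => // j _; exact: mlj.
split=> // [i|j].
  apply: le_trans (l0e i.2); apply: le_measure.
  - by apply/mem_set; exact: ml.
  - by apply/mem_set; exact: ml0.
  - by rewrite lE => x [].
by rewrite sj; apply/funext => x; rewrite /= ffunE.
Qed.

Variables (K : topologicalType) (act : L0 mu G -> K -> K).
Hypotheses (actP : action_on [set: K] act)
  (act_cont : continuous (fun p : L0 mu G * K => act p.1 p.2))
  (compactK : compact [set: K]).

Lemma orbit_uniform (f : K -> R) (e : R) : continuous f -> 0 < e ->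
  exists V : set G, nbhs (1%g : G) V /\
  exists2 r : R, 0 < r &
    forall u, L0_basic V r u -> forall x, `|f (act u x) - f x| <= e.
Proof.
move=> cf e0; have [V [V1 [r r0 Vr]]] := action_near1 actP act_cont compactK cf e0.
by exists V; split => //; exists r => // u uV x; have := Vr u uV x; rewrite mul1g.
Qed.

Section orbit.
Variables (I : finType) (l : X -> I) (ml : measurable_labels l) (k0 : K).

Let phi f (h : I -> G) : R := f (act (labelled mu ml h) k0).

Lemma orbit_rucbn f : continuous f -> rucbn (phi f).
Proof.
move=> cf; split.
  by have [B fB] := continuous_compact_bounded compactK cf; exists B => h; exact: fB.
move=> e /(orbit_uniform cf)[V [V1 [r r0 Vr]]]; exists V => // u h Vu.
have [_ _ actM] := actP.
by rewrite /phi labelledM actM//; apply: Vr; exact: labelled_basicV.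
Qed.

(** If h and h' differ on a set of measure less than r, then h = u h', where u is
    1 outside that set, hence close to 1. The bound does not depend on the
    partition. *)
Lemma orbit_hamming f (e r : R) (V : set G) : nbhs (1%g : G) V ->
  (forall u, L0_basic V r u -> forall x, `|f (act u x) - f x| <= e) ->
  forall h h', hamming (label_weight mu l) h h' < r -> `|phi f h - phi f h'| <= e.
Proof.
move=> V1 Vr h h' hh'; have [_ _ actM] := actP.
pose u i := (h i * (h' i)^-1)%g.
have -> : h = pmulg u h' by apply/funext => i; rewrite /pmulg /u mulgVK.
rewrite /phi labelledM actM//; apply: Vr; apply: labelled_basic => //.
rewrite (eq_bigl (fun i => h i != h' i))// => i; rewrite /u.
apply/idP/idP; apply: contra_neq => hh; first by rewrite hh mulgV.
by rewrite -[LHS](mulgVK (h' i)) hh mul1g.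
Qed.

End orbit.

(** The bound 1 is no restriction, as the functions f j can be scaled. *)
Lemma simple_almost_fixed (J : finType) (s : J -> L0_map X G) (f : J -> K -> R) :
  [set: K] !=set0 ->
  (forall j, simple_map (s j)) -> (forall j, continuous (f j)) ->
  exists x, forall j, `|f j (act (L0_class mu (s j)) x) - f j x| <= 1.
Proof.
move=> [k0 _] simple_s cf; have [_ _ actM] := actP.
have e4 : 0 < 4^-1 :> R by rewrite invr_gt0.
have unif j := orbit_uniform (cf j) e4.
pose V j := projT1 (cid (unif j)).
have V1 j : nbhs (1%g : G) (V j) by rewrite /V; case: cid => ? [].
have unif' j : exists2 r : R, 0 < r &
    forall u, L0_basic (V j) r u -> forall x, `|f j (act u x) - f j x| <= 4^-1.
  by rewrite /V; case: cid => ? [].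
pose r j := projT1 (cid2 (unif' j)).
have [r0 rP] : (forall j, 0 < r j) /\ (forall j u, L0_basic (V j) (r j) u ->
    forall x, `|f j (act u x) - f j x| <= 4^-1).
  by split=> j; rewrite /r; case: (cid2 (unif' j)).
pose B j := projT1 (cid (continuous_compact_bounded compactK (cf j))).
have BP j x : `|f j x| <= B j by rewrite /B; case: cid.
have B0 j : 0 <= B j by exact: le_trans (BP j k0).
(* The Lipschitz constants are fixed before the partition: the size e of the
   pieces is chosen in terms of them, with 17 in place of 16 to make the bound
   on the variances strict. *)
pose C j := 2 * B j / r j.
have C0 j : 0 <= C j by rewrite divr_ge0 ?mulr_ge0// ltW.
pose S := \sum_j C j ^+ 2.
have S0 : 0 <= S by apply: sumr_ge0 => j _; exact: sqr_ge0.
pose e := 17^-1 / (1 + S).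
have e0 : 0 < e by rewrite divr_gt0// ltr_pwDl.
have [I [l [g [ml le_e sg]]]] := common_labels simple_s e0.
pose p := label_weight mu l.
have p0 i : 0 <= p i by exact: label_weight_ge0.
have pe i : p i <= e by rewrite -lee_fin label_weightE.
have sp : \sum_i p i <= 1.
  rewrite -lee_fin -(label_measure_sum mufin ml predT).
  by apply: le_trans mufin; apply: le_measure => //; apply/mem_set => //; exact: measurable_labels_preimage.
(* The sum of the squares of the measures of the pieces is at most the largest
   measure, and tends to 0 for finer partitions. *)
have sp2 : \sum_i p i ^+ 2 <= e.
  apply: (@le_trans _ _ (\sum_i e * p i)).
    by apply: ler_sum => i _; rewrite expr2 ler_wpM2r.
  by rewrite -mulr_sumr ler_piMr// ltW.
pose phi j (h : I -> G) : R := f j (act (labelled mu ml h) k0).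
have rphi j : rucbn (phi j) by exact: orbit_rucbn.
have phiB j h : `|phi j h| <= B j by exact: BP.
pose psi j := inf_conv p (C j) (phi j).
have rpsi j : rucbn (psi j) by exact: (rucbn_inf_conv p0 (phiB j) (C0 j)).
have lpsi j : coord_lipschitz (psi j) (fun i => C j * p i).
  exact: (inf_conv_lipschitz p0 (phiB j) (C0 j)).
have psi_phi j h : `|psi j h - phi j h| <= 4^-1.
  rewrite ler_distl (le_trans (inf_conv_le p0 (phiB j) (C0 j) h)) ?lerDl// andbT.
  apply: (inf_conv_ge p0 (phiB j) (C0 j) (d := r j)) => //.
    by rewrite /C divfK// gt_eqF.
  move=> h'; exact: (orbit_hamming ml k0 (V1 j) (@rP j)).
have [|h hP] := concentrated_point meanM g (c := fun j i => C j * p i) (e := 16^-1) rpsi lpsi.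
  apply: (@le_lt_trans _ _ (S * e)).
    rewrite /S mulr_suml; apply: ler_sum => j _.
    under eq_bigr do rewrite exprMn.
    by rewrite -mulr_sumr ler_wpM2l// sqr_ge0.
  rewrite /e mulrCA; apply: (@le_lt_trans _ _ (17^-1 * 1)).
    by rewrite ler_pM2l// ler_pdivrMr ?ltr_pwDl// mul1r lerDr.
  lra.
exists (act (labelled mu ml h) k0) => j.
have -> : L0_class mu (s j) = labelled mu ml (g j).
  by apply/L0_classP; apply: aeW => x /=; rewrite sg.
rewrite -actM// -labelledM -/(phi j (pmulg (g j) h)) -/(phi j h).
(* Replacing phi by psi costs 1 / 4 twice, and the two values of psi differ by at
   most 1 / 2. *)
have half : `|psi j (pmulg (g j) h) - psi j h| <= 2^-1.
  rewrite -(ler_pXn2r (n := 2))// ?nnegrE// real_normK ?num_real//.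
  by apply: le_trans (hP j) _; lra.
have := psi_phi j (pmulg (g j) h); have := psi_phi j h; move: half.
rewrite !ler_norml => /andP[? ?] /andP[? ?] /andP[? ?]; apply/andP; split; lra.
Qed.

End simple_maps_fixed_point.

(** * From almost fixed points to a fixed point *)

Lemma compact_closed_family (K : topologicalType) (I : choiceType) (Z : I -> set K) :
  compact [set: K] -> (forall i, closed (Z i)) ->
  (forall D : {fset I}, exists x, forall i, i \in D -> Z i x) ->
  exists x, forall i, Z i x.
Proof.
move=> compactK cZ finZ.
have [x0 _] := finZ fset0.
have FF : ProperFilter (filter_from (finI_from [set: I] Z) id).
  apply: finI_filter => D _; have [x xD] := finZ D.
  by exists x => i; exact: xD.
have [|x [_ xF]] := compactK _ FF; first exact: filterT.
exists x => i; apply: (cZ i) => A nA.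
have [|y [yZ yA]] := xF (Z i) A _ nA; last by exists y.
by exists (Z i) => //; exact: finI_from1.
Qed.

Lemma continuous_separation (R : realType) (K : topologicalType) (x y : K) :
  hausdorff_space K -> compact [set: K] ->
  (forall f : K -> R, continuous f -> f x = f y) -> x = y.
Proof.
move=> hK cK fxy; apply: contrapT => xy.
have nK : normal_space K by exact: compact_normal.
have c1 (z : K) : closed [set z] by exact: (accessible_closed_set1 (hausdorff_accessible hK)).
have /(@uniform_separatorP _ R)[f [cf _ f0 f1]] : uniform_separator [set x] [set y].
  apply: normal_uniform_separator => //.
  by apply/seteqP; split => // z [/= -> /xy].
have : f x = 0 by apply: f0; exists x.
have : f y = 1 by apply: f1; exists y.
by rewrite (fxy f cf) => -> /eqP; rewrite oner_eq0.
Qed.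

Section fixed_point.
Variables (R : realType) (G : topologicalGroupType).
Variables (d : measure_display) (X : measurableType d).
Variable (mu : {measure set X -> \bar R}).
Hypothesis mufin : (mu setT <= 1)%E.
Hypothesis small_labels : forall e : R, 0 < e -> exists (I : finType) (l : X -> I),
  measurable_labels l /\ forall i, (mu (l @^-1` [set i]) <= e%:E)%E.
Variable (M : (G -> R) -> R).
Hypothesis meanM : invariant_mean M.
Variables (K : topologicalType) (act : L0 mu G -> K -> K).
Hypotheses (actP : action_on [set: K] act)
  (act_cont : continuous (fun p : L0 mu G * K => act p.1 p.2))
  (hausK : hausdorff_space K) (K0 : [set: K] !=set0) (compactK : compact [set: K]).

Lemma act_point_continuous a : continuous (act a).
Proof.
move=> x; apply: (@continuous2_cvg _ _ _ _ (nbhs x) _ (fun=> a) id act a x).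
- exact: (@act_cont (a, x)).
- exact: cvg_cst.
- exact: cvg_id.
Qed.

Lemma act_group_continuous x : continuous (act^~ x).
Proof.
move=> a; apply: (@continuous2_cvg _ _ _ _ (nbhs a) _ id (fun=> x) act a x).
- exact: (@act_cont (a, x)).
- exact: cvg_id.
- exact: cvg_cst.
Qed.

Lemma simple_fixed_point :
  exists x, forall s : L0_map X G, simple_map s -> act (L0_class mu s) x = x.
Proof.
pose S := {s : L0_map X G | simple_map s}.
pose F := {f : K -> R | continuous f}.
(* Scaling f shows that a point in all the sets Z has f (s x) = f x for all s and
   f, and the continuous functions on K separate points. *)
pose Z (i : {classic (S * F)}) : set K :=
  [set x | `|sval i.2 (act (L0_class mu (sval i.1)) x) - sval i.2 x| <= 1].
have [||x xZ] := compact_closed_family (Z := Z) compactK.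
- move=> [[s ps] [f cf]].
  rewrite (_ : Z _ = (fun x => `|f (act (L0_class mu s) x) - f x|) @^-1` [set r : R | r <= 1])//.
  apply: preimage_closed; last exact: closed_le.
  move=> x _; apply: (@continuous_comp _ _ _ (fun x => f (act (L0_class mu s) x) - f x) (fun r => `|r|)); last exact: norm_continuous.
  apply: (@continuousB _ R^o); last exact: cf.
  by apply: continuous_comp; [exact: act_point_continuous|exact: cf].
- move=> D.
  have [x xD] := simple_almost_fixed mufin small_labels meanM actP act_cont compactK
    (J := D) (s := fun j => sval (val j).1) (f := fun j => sval (val j).2) K0
    (fun j => svalP (val j).1) (fun j => svalP (val j).2).
  by exists x => i iD; exact: (xD [` iD]%fset).
exists x => s ps; apply: (@continuous_separation R) => // f cf.
apply/eqP; rewrite -subr_eq0 -normr_le0; apply/ler_addgt0Pl => e e0; rewrite addr0.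
have ce : continuous (fun y => e^-1 * f y).
  move=> y; apply: (@continuous_comp _ _ _ f ( *%R e^-1)); first exact: cf.
  exact: mulrl_continuous.
have := xZ (exist _ s ps, exist _ _ ce).
by rewrite /Z /= -mulrBr normrM gtr0_norm ?invr_gt0// mulrC ler_pdivrMr// mul1r.
Qed.

(** The stabilizer of a point is a closed subgroup. It contains the simple maps,
    hence the Borel maps in their closure, hence the group that these generate. *)
Lemma fixed_point_of_approximation :
  (forall (f : X -> G) (V : set G) (e : R), borel_measurable f ->
     nbhs (1%g : G) V -> 0 < e -> exists2 s : L0_map X G, simple_map s &
       ((mu^*)%mu [set x | ~ V ((f x)^-1 * s x)%g] < e%:E)%E) ->
  exists x, forall a : L0 mu G, act a x = x.
Proof.
move=> dense; have [x xs] := simple_fixed_point; exists x => a.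
have [_ _ actM] := actP.
suff fix_class f : L0_carrier f -> forall cf : L0_carrier f,
    act (L0_class mu (MkL0Map cf)) x = x.
  by rewrite -(L0_classK a); case: (repr a) => f cf; exact: fix_class.
elim=> {f} [f mf cf|f g cf IHf cg IHg cfg]; last first.
  rewrite (_ : L0_class mu (MkL0Map cfg) =
      (L0_class mu (MkL0Map cf) * L0_class mu (MkL0Map cg))%g).
    by rewrite actM// IHg IHf.
  rewrite [RHS]L0_class_mul; congr (L0_class mu _).
  by rewrite /L0_map_mul /=; congr MkL0Map; exact: Prop_irrelevance.
set b := L0_class mu _.
have cfix : closed [set c : L0 mu G | act c x = x].
  apply: (@preimage_closed _ _ (act^~ x) [set x]).
    by move=> c _; exact: act_group_continuous.
  exact: (accessible_closed_set1 (hausdorff_accessible hausK)).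
apply: cfix => A [V [V1 [e e0 VA]]].
have [s simple_s sV] := dense f V e mf V1 e0.
exists (L0_class mu s); split; first exact: xs.
rewrite (_ : L0_class mu s = (b * (b^-1 * L0_class mu s))%g); last by rewrite mulVKg.
apply: VA.
rewrite (_ : (b^-1 * L0_class mu s)%g =
    L0_class mu (L0_map_mul (L0_map_inv (MkL0Map cf)) s)).
  exact/L0_basic_class.
by rewrite -L0_class_mul -L0_class_inv.
Qed.

End fixed_point.

(** * Distribution functions of diffuse measures *)

(** All subsets of R have a k-preimage that is measurable, and the image under k of
    the measure on D is diffuse. *)
Section diffuse.
Variables (R : realType) (d : measure_display) (X : measurableType d).
Variables (mu : {measure set X -> \bar R}) (D : set X) (k : X -> R).
Hypotheses (mufin : (mu setT <= 1)%E) (mD : measurable D).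
Hypothesis mk : forall A : set R, measurable (k @^-1` A).
Hypothesis diffuse : forall t, mu (D `&` k @^-1` [set t]) = 0%E.

Let rho (A : set R) := mu (D `&` k @^-1` A).

Let mrho A : measurable (D `&` k @^-1` A).
Proof. exact: measurableI. Qed.

Let rho_le A B : A `<=` B -> (rho A <= rho B)%E.
Proof.
by move=> AB; apply: le_measure; [exact/mem_set|exact/mem_set|move=> x [Dx /AB]].
Qed.

Let rho_fin A : rho A \is a fin_num.
Proof.
rewrite ge0_fin_numE//; apply: le_lt_trans (ltry 1); apply: le_trans mufin.
by apply: le_measure => //; exact/mem_set.
Qed.

Definition cdf_of (t : R) : R := fine (rho [set s | s <= t]).

Let cdf_ofE t : (cdf_of t)%:E = rho [set s | s <= t].
Proof. by rewrite /cdf_of fineK. Qed.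

Lemma cdf_of_homo : {homo cdf_of : x y / x <= y}.
Proof.
move=> x y xy; rewrite -lee_fin !cdf_ofE; apply: rho_le => s /= sx.
exact: le_trans xy.
Qed.

Let rho_itv x y : x <= y -> rho `]x, y]%classic = (cdf_of y - cdf_of x)%:E.
Proof.
move=> xy; rewrite EFinB !cdf_ofE.
have -> : rho [set s | s <= y] = (rho [set s | (s <= x)%R] + rho `]x, y]%classic)%E.
  rewrite /rho -measureU//.
    congr (mu _); rewrite -setIUr; congr (D `&` _); apply/seteqP; split => z /=.
      by move=> zy; case: (leP (k z) x) => zx; [left|right; rewrite /= in_itv/= zx].
    by case=> [zx|]; [exact: le_trans xy|rewrite /= in_itv/= => /andP[]].
  by apply/seteqP; split => // z [[_ /= zx] [_ /=]]; rewrite in_itv/= ltNge zx.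
by rewrite addeAC subee ?add0e.
Qed.

Let rho_subsingleton A : (forall s t, A s -> A t -> s = t) -> rho A = 0%E.
Proof.
move=> subA; have [[t At]|noA] := pselect (exists t, A t).
  apply/eqP; rewrite eq_le measure_ge0 andbT -(diffuse t).
  by apply: rho_le => s As; exact: subA.
rewrite /rho (_ : A = set0) ?preimage_set0 ?setI0 ?measure0//.
by apply/seteqP; split => // t At; apply: noA; exists t.
Qed.

(** The preimage J of the interval under the distribution function is convex. Apart
    from its least and its greatest element, if any, it is the union of the
    intervals ]q, q'] with rational q and q' in J. Finitely many of these lie in
    one interval ]x, y] with x and y in J, whose measure is the difference of
    two values in ]a, b]. *)
Lemma cdf_of_preimage_itv a b : a <= b ->
  (mu (D `&` (cdf_of \o k) @^-1` `]a, b]%classic) <= (b - a)%:E)%E.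
Proof.
move=> ab; pose J := cdf_of @^-1` `]a, b]%classic.
change (rho J <= (b - a)%:E)%E.
have JE t : J t = (a < cdf_of t <= b) :> Prop by rewrite /J /preimage /= in_itv.
have Jconv s t u : J s -> J u -> s <= t <= u -> J t.
  rewrite !JE => /andP[as_ _] /andP[_ ub] /andP[st tu]; apply/andP; split.
    exact: lt_le_trans as_ (cdf_of_homo st).
  exact: le_trans (cdf_of_homo tu) ub.
have Jitv x y : J x -> J y -> x <= y -> (rho `]x, y]%classic <= (b - a)%:E)%E.
  rewrite !JE => /andP[ax _] /andP[_ yb] xy; rewrite rho_itv// lee_fin; lra.
have [[x0 Jx0]|noJ] := pselect (exists t, J t); last first.
  rewrite (_ : J = set0) ?/rho ?preimage_set0 ?setI0 ?measure0 ?lee_fin ?subr_ge0//.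
  by apply/seteqP; split => // t Jt; apply: noJ; exists t.
pose S n : set R := if (choice.unpickle n : option (rat * rat)) is Some (q, q')
  then [set s | [/\ J (ratr q), J (ratr q') & ratr q < s <= ratr q']] else set0.
pose T n := \big[setU/set0]_(i < n) S i.
have T_itv n : exists x y, [/\ J x, J y, x <= y & T n `<=` `]x, y]%classic].
  elim: n => [|n [x [y [Jx Jy xy Txy]]]].
    by exists x0, x0; split => //; rewrite /T big_ord0.
  have [q [q' [Jq Jq' Sq]]] : exists q q', [/\ J q, J q' & S n `<=` `]q, q']%classic].
    rewrite /S; case: (choice.unpickle n) => [[q q']|]; last by exists x0, x0; split => // ? [].
    have [[Jq Jq']|nJ] := pselect (J (ratr q) /\ J (ratr q')).
      by exists (ratr q), (ratr q'); split => // s [].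
    by exists x0, x0; split => // s [Jq Jq' _]; exfalso; apply: nJ.
  exists (Num.min x q), (Num.max y q'); split.
  - by rewrite /Num.min; case: ifP.
  - by rewrite /Num.max; case: ifP.
  - by rewrite ge_min le_max xy.
  - move=> s; rewrite /T big_ord_recr /= => -[/Txy|/Sq] /=; rewrite !in_itv/= => /andP[lt le]; apply/andP; split.
    + by rewrite gt_min lt.
    + by rewrite le_max le.
    + by rewrite gt_min lt orbT.
    + by rewrite le_max le orbT.
have rhoT n : (rho (T n) <= (b - a)%:E)%E.
  by have [x [y [Jx Jy xy Txy]]] := T_itv n; apply: le_trans (Jitv x y Jx Jy xy); exact: rho_le.
have rhoS : (rho (\bigcup_n S n) <= (b - a)%:E)%E.
  have cT : mu (D `&` k @^-1` T n.+1) @[n --> \oo] --> rho (\bigcup_n S n).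
    have -> : rho (\bigcup_n S n) = mu (\bigcup_n (D `&` k @^-1` T n.+1)).
      by rewrite /rho -setI_bigcupr -preimage_bigcup /T bigcup_bigsetU_bigcup.
    apply: (@nondecreasing_cvg_mu _ _ _ mu (fun n => D `&` k @^-1` T n.+1)) => //.
      by apply: bigcupT_measurable => n; exact: mrho.
    move=> n m nm; apply/subsetPset => x [Dx Tx]; split => //.
    by move: Tx; rewrite /T /preimage /=; apply: subset_bigsetU; rewrite ltnS.
  rewrite -(cvg_lim _ cT)//; apply: lime_le; first by apply/cvg_ex; eexists; exact: cT.
  by apply: nearW => n; exact: rhoT.
pose Mn := [set t | J t /\ forall s, J s -> t <= s].
pose Mx := [set t | J t /\ forall s, J s -> s <= t].
have JS : J `<=` \bigcup_n S n `|` (Mn `|` Mx).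
  move=> t Jt; have [[s [Js st]]|nl] := pselect (exists s, J s /\ s < t); last first.
    right; left; split => // s Js; rewrite leNgt; apply/negP => st; apply: nl; by exists s.
  have [[u [Ju tu]]|nu] := pselect (exists u, J u /\ t < u); last first.
    right; right; split => // u Ju; rewrite leNgt; apply/negP => tu; apply: nu; by exists u.
  left; have [q] := rat_in_itvoo st; rewrite in_itv /= => /andP[sq qt].
  have [q'] := rat_in_itvoo tu; rewrite in_itv /= => /andP[tq' q'u].
  exists (choice.pickle (q, q')); first exact: I.
  rewrite /S (choice.pickleK (q, q')); split.
  - by apply: Jconv Js Jt _; rewrite !ltW.
  - by apply: Jconv Jt Ju _; rewrite !ltW.
  - by rewrite qt ltW.
apply: le_trans (rho_le JS) _.
have subMn : rho Mn = 0%E.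
  by apply: rho_subsingleton => s t [Js sm] [Jt tm]; apply/eqP; rewrite eq_le sm// tm.
have subMx : rho Mx = 0%E.
  by apply: rho_subsingleton => s t [Js sm] [Jt tm]; apply/eqP; rewrite eq_le sm// tm.
have rhoU A B : (rho (A `|` B) <= rho A + rho B)%E.
  by rewrite /rho preimage_setU setIUr; exact: measureU2.
apply: le_trans (rhoU _ _) _.
rewrite -[leRHS]adde0; apply: leeD => //.
by apply: le_trans (rhoU _ _) _; rewrite subMn subMx adde0.
Qed.

(** Lebesgue measure is the infimum over the covers by intervals. *)
(** Lebesgue measure is the infimum of the total lengths of covers by intervals,
    so the bound on intervals passes to all sets, measurable or not. *)
Lemma cdf_of_lebesgue (A : set R) :
  (mu (D `&` (cdf_of \o k) @^-1` A) <= lebesgue_measure A)%E.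
Proof.
apply: le_ereal_inf_tmp => _ [B [mB AB] <-].
have mg C : measurable (D `&` (cdf_of \o k) @^-1` C) by exact: (mrho (cdf_of @^-1` C)).
apply: (@le_trans _ _ (mu (\bigcup_n (D `&` (cdf_of \o k) @^-1` B n)))).
  apply: le_measure; [exact/mem_set| |].
    by apply/mem_set; exact: bigcupT_measurable.
  by move=> x [Dx /AB[n _ Bn]]; exists n.
apply: (@le_trans _ _ (\sum_(n <oo) mu (D `&` (cdf_of \o k) @^-1` B n))%E).
  by apply: measure_sigma_subadditive => //; exact: bigcupT_measurable.
apply: lee_nneseries => // n _.
have [[a b] _ /= <-] := mB n.
have [ab|ba] := leP a b.
  by apply: le_trans (cdf_of_preimage_itv ab) _; rewrite wlength_itv_bnd.
rewrite (_ : `]a, b]%classic = set0) ?preimage_set0 ?setI0 ?measure0 ?wlength0//.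
by apply: set_itv_ge; rewrite bnd_simp -leNgt ltW.
Qed.
End diffuse.

(** * Transversals of the real line modulo the rationals *)

Section rational_transversals.
Variable (R : realType).
Local Notation lambda := (@lebesgue_measure R).

Lemma measurable_shift (r : R) : measurable_fun setT (fun x : R => x - r).
Proof. by apply: measurable_funB => //; exact: measurable_cst. Qed.

Lemma lebesgue_measure_shift (A : set R) (r : R) : measurable A ->
  lambda ((fun x => x - r) @^-1` A) = lambda A.
Proof.
move=> mA; apply/esym.
pose nu := pushforward lambda (fun x : measurableTypeR R => x - r : measurableTypeR R).
have mnu : measurable_fun [set: measurableTypeR R] (fun x : measurableTypeR R => x - r : measurableTypeR R).
  exact: measurable_shift.
apply: (@lebesgue_measure_unique R nu) => // _ [[a b] _ <-] /=.
rewrite /nu /pushforward.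
rewrite (_ : _ @^-1` _ = `]a + r, b + r]%classic).
  rewrite !lebesgue_measure_itv/= !lte_fin ltrD2r; case: ifP => // _.
  by rewrite -!EFinB; congr (_%:E); ring.
by apply/seteqP; split => x /=; rewrite !in_itv/= ltrBrDr lerBlDr.
Qed.

(** The translates of K by 1 / (n + 1) are disjoint, have the same measure and lie
    in a bounded set. *)
Lemma rational_transversal_null (K : set R) : compact K ->
  (forall x y, K x -> K y -> (exists q : rat, x - y = ratr q) -> x = y) ->
  lambda K = 0%E.
Proof.
move=> cK trK; have mK : measurable K by exact: compact_measurable.
have [B [_ KB]] := compact_bounded (cK : compact (K : set R^o)).
have {}KB x : K x -> `|x| <= B + 1 by apply: KB; rewrite ltrDl.
pose r n : R := n.+1%:R^-1.
pose T n := (fun x => x - r n) @^-1` K.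
have mT n : measurable (T n).
  by rewrite -[T n]setTI; exact: measurable_shift.
have tT : trivIset setT T.
  apply/trivIsetP => i j _ _ ij; apply/seteqP; split => // x [/= Ti Tj].
  have : x - r i = x - r j.
    apply: (trK _ _ Ti Tj); exists (j.+1%:R^-1 - i.+1%:R^-1).
    by rewrite rmorphB /= !fmorphV !rmorph_nat -/(r i) -/(r j); ring.
  move=> /addrI /oppr_inj /invr_inj /eqP; rewrite eqr_nat eqSS.
  by rewrite (negbTE ij).
have r01 n : 0 <= r n <= 1.
  by rewrite /r invr_ge0 ler0n invf_le1// ler1n.
have TB : \bigcup_n T n `<=` `[- (B + 2), B + 2]%classic.
  move=> x [n _ /KB]; rewrite ler_norml => /andP[? ?]; have /andP[? ?] := r01 n.
  by rewrite /= in_itv/=; apply/andP; split; lra.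
have finT : (lambda (\bigcup_n T n) < +oo)%E.
  apply: (@le_lt_trans _ _ (lambda `[- (B + 2), B + 2]%classic)).
    by apply: le_measure => //; apply/mem_set => //; exact: bigcupT_measurable.
  by rewrite lebesgue_measure_itv/=; case: ifP => _; rewrite ?ltry.
have TK n : lambda (T n) = lambda K by exact: lebesgue_measure_shift.
have finK : lambda K \is a fin_num by rewrite ge0_fin_numE//; exact: compact_finite_measure.
pose k := fine (lambda K); have kE : lambda K = k%:E by rewrite fineK.
have sumT n : ((k *+ n)%:E <= lambda (\bigcup_n T n))%E.
  rewrite measure_bigcup//; last by move=> i _; exact: mT.
  apply: (@le_trans _ _ (\sum_(0 <= i < n | i \in setT) lambda (T i))%E).
    rewrite (eq_bigl xpredT) => [|i]; last by rewrite in_setT.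
    by under eq_bigr do rewrite TK kE; rewrite sumEFin sumr_const_nat subn0.
  by apply: nneseries_lim_ge => i _ _; exact: measure_ge0.
have finT' : lambda (\bigcup_n T n) \is a fin_num by rewrite ge0_fin_numE.
have k0 : 0 <= k by rewrite fine_ge0.
rewrite kE; congr (_%:E); apply/eqP; rewrite eq_le k0 andbT leNgt; apply/negP => kp.
have L0 : 0 <= fine (lambda (\bigcup_n T n)) / k by rewrite divr_ge0// fine_ge0.
have := sumT (Num.bound (fine (lambda (\bigcup_n T n)) / k)).
rewrite -(fineK finT') lee_fin -mulr_natr mulrC -ler_pdivlMr//.
by rewrite leNgt archi_boundP.
Qed.
Lemma rational_rep : exists rep : R -> R,
  (forall z, exists q : rat, rep z - z = ratr q) /\
  (forall z z', (exists q : rat, z - z' = ratr q) -> rep z = rep z').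
Proof.
pose cls z := [set w : R | exists q : rat, w - z = ratr q].
exists (fun z => xget 0 (cls z)); split => [z|z z' [q zz']].
  by apply: (@xgetPex _ 0 (cls z)); exists z, 0; rewrite subrr rmorph0.
congr (xget 0 _); apply/seteqP; split => w [r wr].
  exists (r + q); rewrite rmorphD /= -zz' -wr; ring.
exists (r - q); rewrite rmorphB /= -zz' -wr; ring.
Qed.

End rational_transversals.

(** * Measurable sets in Lebesgue spaces *)

Section conegligible.
Local Open Scope measure_scope.
Variables (R : realType) (d : measure_display) (X : measurableType d).
Variable (mu : {measure set X -> \bar R}).

(** The isomorphism with the interval is defined on the set X0 only, which need not
    be measurable; this makes up for it. *)
Lemma conegligibleI (X0 A : set X) : mu.-negligible (~` X0) -> measurable A ->
  completed_algebra_gen mu (X0 `&` A) /\ mu^* (X0 `&` A) = mu A.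
Proof.
move=> nX0 mA; split.
  have [N [mN N0 X0N]] := nX0; exists (A `\` N); first exact: measurableD.
  exists (X0 `&` A `&` N); first by exists N; split => // x [].
  apply/seteqP; split => x.
    case=> [[Ax nNx]|[]//]; split => //.
    by apply: contrapT => nX; apply: nNx; exact: X0N.
  by move=> [X0x Ax]; have [Nx|nNx] := pselect (N x); [right|left].
rewrite -(measurable_mu_extE mu mA); apply/eqP; rewrite eq_le; apply/andP; split.
  by apply: le_mu_ext => x [].
rewrite -[leRHS]adde0 -(mu_ext_negligible nX0).
apply: le_trans (outer_measureU2 _ _ _); apply: le_mu_ext => x Ax.
by have [|] := pselect (X0 x); [left|right].
Qed.

Lemma completed_inner (A : set X) : completed_algebra_gen mu A ->
  exists C, [/\ measurable C, C `<=` A, mu.-negligible (A `\` C) & mu C = mu^* A].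
Proof.
move=> [C mC [N nN <-]]; exists C; split => //.
  by apply: negligibleS nN => x [[]].
rewrite -(measurable_mu_extE mu mC); apply/eqP; rewrite eq_le; apply/andP; split.
  by apply: le_mu_ext => x; left.
rewrite -[leRHS]adde0 -(mu_ext_negligible nN).
exact: outer_measureU2.
Qed.

End conegligible.

Section lebesgue_spaces.
Local Open Scope measure_scope.
Variables (R : realType) (d : measure_display) (X : measurableType d).
Variable (mu : {measure set X -> \bar R}).
Local Notation lambda := (@lebesgue_measure R).
Let nu := mrestr lambda (measurable_itv `[0%R, 1%R]).
Variables (X0 : set X) (Y0 : set R) (phi : X -> R).
Hypotheses (nX0 : mu.-negligible (~` X0)) (nY0 : nu.-negligible (~` Y0)).
Hypothesis phibij : set_bij X0 Y0 phi.
Hypothesis phiP : forall B, B `<=` Y0 ->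
  (completed_algebra_gen nu B <-> completed_algebra_gen mu (X0 `&` phi @^-1` B)) /\
  (completed_algebra_gen nu B -> mu^* (X0 `&` phi @^-1` B) = nu^* B).

Lemma preimage_completed (B : set R) : measurable B ->
  completed_algebra_gen mu (X0 `&` phi @^-1` B) /\
  mu^* (X0 `&` phi @^-1` B) = lambda (B `&` `[0, 1]%classic).
Proof.
move=> mB; have [cB nuB] := conegligibleI nY0 mB.
have [phiX _ _] := phibij.
have -> : X0 `&` phi @^-1` B = X0 `&` phi @^-1` (Y0 `&` B).
  apply/seteqP; split => x [X0x Bx]; split => //; last by case: Bx.
  by split => //; exact: phiX.
have [c m] := phiP (@subIsetl _ Y0 B).
by split; [exact/c|rewrite m].
Qed.

Lemma image_completed (A : set X) : measurable A ->
  completed_algebra_gen nu (phi @` (X0 `&` A)) /\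
  nu^* (phi @` (X0 `&` A)) = mu A.
Proof.
move=> mA; have [cA muA] := conegligibleI nX0 mA.
have [phiX phiI _] := phibij.
have sub : phi @` (X0 `&` A) `<=` Y0 by move=> _ [x [X0x _] <-]; exact: phiX.
have E : X0 `&` phi @^-1` (phi @` (X0 `&` A)) = X0 `&` A.
  apply/seteqP; split => x [X0x Ax]; split => //; last by exists x.
  have [z [X0z Az] zx] := Ax; suff -> : x = z by [].
  by apply: phiI; [exact/mem_set|exact/mem_set|rewrite zx].
have [c m] := phiP sub; rewrite E in c m.
have cI : completed_algebra_gen nu (phi @` (X0 `&` A)) by exact/c.
by split => //; rewrite -m.
Qed.

Lemma lebesgue_space_le1 : (mu setT <= 1)%E.
Proof.
have [_ <-] := conegligibleI nX0 (@measurableT _ X).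
have [_] := preimage_completed (@measurableT _ (measurableTypeR R)).
rewrite preimage_setT setIT => ->; rewrite setTI lebesgue_measure_itv/= lte_fin ltr01.
by rewrite -EFinB subr0.
Qed.

(** The pieces are pulled back from a subdivision of [0, 1]. The preimages are
    measurable up to null sets only, and the sets C i that replace them may
    overlap; so a point is labelled by the set of all i such that C i contains
    it. *)
Lemma lebesgue_space_small_labels (e : R) : 0 < e -> exists (I : finType) (l : X -> I),
  measurable_labels l /\ forall i, (mu (l @^-1` [set i]) <= e%:E)%E.
Proof.
move=> e0; pose n := (Num.bound e^-1).
have n0 : 0 < n%:R :> R by apply: lt_trans (archi_boundP _); rewrite ?invr_ge0 ?invr_gt0// ltW.
have ne : n%:R^-1 <= e.
  by rewrite -[leRHS]invrK lef_pV2 ?posrE ?invr_gt0//; apply: ltW; apply: archi_boundP; rewrite invr_ge0 ltW.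
(* For i <= n, an interval of length 1 / n; the last set has measure 0. *)
pose B (i : nat) : set R := if (i <= n)%N then `[i%:R / n%:R, i.+1%:R / n%:R]%classic
  else ~` `[0, 1]%classic.
have mB i : measurable (B i).
  by rewrite /B; case: ifP => // _; exact: measurableC.
have Bcover t : exists i : 'I_n.+2, B i t.
  have [t01|nt01] := pselect (`[0, 1]%classic t); last first.
    by exists ord_max; rewrite /B /= ltnn.
  move: t01; rewrite /= in_itv/= => /andP[t0 t1].
  have tn0 : 0 <= t * n%:R by rewrite mulr_ge0// ltW.
  have tn : (Num.truncn (t * n%:R) <= n)%N.
    by rewrite truncn_le_nat (le_lt_trans (ler_piMl _ t1)) ?ltW// ltr_nat.
  exists (inord (Num.truncn (t * n%:R))); rewrite inordK; last by rewrite ltnS (leq_trans tn).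
  rewrite /B tn /= in_itv/= ler_pdivrMr// ler_pdivlMr//.
  by have /andP[-> /ltW ->] := truncn_itv tn0.
have Be i : (lambda (B i `&` `[0%R, 1%R]%classic) <= e%:E)%E.
  rewrite /B; case: ifP => _; last by rewrite setICl measure0 lee_fin ltW.
  apply: (@le_trans _ _ (lambda `[(i%:R / n%:R)%R, (i.+1%:R / n%:R)%R]%classic)).
    by apply: le_measure; [exact/mem_set/measurableI|exact/mem_set|exact: subIsetl].
  rewrite lebesgue_measure_itv/= lte_fin; case: ifP => _; last by rewrite lee_fin ltW.
  by rewrite -EFinB -mulrBl -natrB// subSnn mul1r lee_fin.
pose C i := projT1 (cid (completed_inner (preimage_completed (mB i)).1)).
have CP i : [/\ measurable (C i), C i `<=` X0 `&` phi @^-1` B i,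
    mu.-negligible ((X0 `&` phi @^-1` B i) `\` C i) & (mu (C i) <= e%:E)%E].
  rewrite /C; case: cid => /= C' [? ? ? ->]; split => //.
  by rewrite (preimage_completed (mB i)).2.
pose l x : {set 'I_n.+2} := finset (fun i : 'I_n.+2 => `[< C i x >]).
have lE S : l @^-1` [set S] =
    \bigcap_(i in [set: 'I_n.+2]) (if i \in S then C i else ~` C i).
  apply/seteqP; split => x /=.
    move=> <- i _; case: ifP; rewrite inE => /asboolP //.
  move=> xS; apply/setP => i; rewrite inE; have := xS i Logic.I.
  by case: ifP => _ Cx; [exact/asboolP|apply/asboolP].
exists {set 'I_n.+2}, l; have ml : measurable_labels l.
  move=> S; rewrite lE; apply: fin_bigcap_measurable => // i _.
  by have [mC _ _ _] := CP i; case: ifP => // _; exact: measurableC.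
split => // S.
have [->|[i iS]] := set_0Vmem S.
  apply: (@le_trans _ _ 0%E); last by rewrite lee_fin ltW.
  rewrite le_eqVlt; apply/orP; left; apply/eqP/measure_negligible; first exact: ml.
  apply: (negligibleS (A := ~` X0 `|` \bigcup_i ((X0 `&` phi @^-1` B i) `\` C i))); last first.
    by apply: negligibleU => //; apply: negligible_bigcup => i; have [] := CP i.
  rewrite lE => x xC; have [X0x|] := pselect (X0 x); last by left.
  have [i Bi] := Bcover (phi x); right; exists i => //; split => //.
  by have := xC i Logic.I; rewrite finset.in_set0.
have [mC _ _ Ce] := CP i; apply: le_trans Ce; apply: le_measure; try exact/mem_set.
by rewrite lE => x /(_ i Logic.I); rewrite iS.
Qed.

(** If D had positive measure, it would yield a compact set of positive Lebesgue
    measure inside a transversal of R / Q. In the proof, k codes the fibers by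
    real numbers, g is its composition with the distribution function, A q is a
    rational translate of a transversal, and G is g, carried over to the
    interval. *)
Lemma null_fibers_union (Y : Type) (f : X -> Y) (D : set X) :
  (forall B : set Y, measurable (f @^-1` B)) -> measurable D ->
  (forall x, D x -> mu (f @^-1` [set f x]) = 0%E) -> mu D = 0%E.
Proof.
move=> mf mD fiber0; have mufin : (mu setT <= 1)%E := lebesgue_space_le1.
have [_ phiI _] := phibij.
apply: contrapT => /eqP; rewrite -measure_gt0 => muD.
have [x0 _] : D !=set0.
  by apply/set0P; apply/eqP => D0; move: muD; rewrite D0 measure0 ltxx.
pose sel y := xget x0 [set x | X0 x /\ f x = y].
have selP x : X0 x -> X0 (sel (f x)) /\ f (sel (f x)) = f x.
  by move=> X0x; apply: (@xgetPex _ x0 [set z | X0 z /\ f z = f x]); exists x.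
pose k x := phi (sel (f x)).
have mk (A : set R) : measurable (k @^-1` A) by exact: (mf ((phi \o sel) @^-1` A)).
have k_inj x y : X0 x -> X0 y -> k x = k y -> f x = f y.
  move=> /selP[X0x fx] /selP[X0y fy] kxy; rewrite -fx -fy; congr f.
  by apply: phiI => //; exact/mem_set.
have diffuse t : mu (D `&` k @^-1` [set t]) = 0%E.
  apply: measure_negligible; first exact: measurableI.
  have [[x1 [X0x1 Dx1 kx1]]|nx] := pselect (exists x, [/\ X0 x, D x & k x = t]).
    apply: (negligibleS (A := ~` X0 `|` f @^-1` [set f x1])).
      move=> x [Dx kx]; have [X0x|] := pselect (X0 x); [right|by left].
      by apply: k_inj => //; rewrite kx1; exact: kx.
    by apply: negligibleU => //; apply/negligibleP; [exact: mf|exact: fiber0].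
  by apply: negligibleS nX0 => x [Dx kx] X0x; apply: nx; exists x.
pose g : X -> R := cdf_of mu D k \o k.
have mg (A : set R) : measurable (g @^-1` A) by exact: (mk (cdf_of mu D k @^-1` A)).
have g_lambda (A : set R) : (mu (D `&` g @^-1` A) <= lambda A)%E.
  exact: (cdf_of_lebesgue mufin mD mk diffuse).
(* The inverse of phi on Y0. *)
pose psi y := xget x0 [set x | X0 x /\ phi x = y].
have psiK x : X0 x -> psi (phi x) = x.
  move=> X0x; have [X0z zx] : X0 (psi (phi x)) /\ phi (psi (phi x)) = phi x.
    by apply: (@xgetPex _ x0 [set z | X0 z /\ phi z = phi x]); exists x.
  by apply: phiI => //; exact/mem_set.
pose G y := g (psi y).
have GE x : X0 x -> G (phi x) = g x by move=> X0x; rewrite /G psiK.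
have [rep [repP rep_eq]] := rational_rep R.
pose A (q : rat) := [set z : R | rep z - z = ratr q].
have [q muAq] : exists q, (0 < mu (D `&` g @^-1` A q))%E.
  apply: contrapT => /forallNP A0; move: muD; rewrite measure_gt0 => /negP; apply.
  apply/eqP/measure_negligible => //.
  pose H n := if (choice.unpickle n : option rat) is Some q then D `&` g @^-1` A q else set0.
  apply: (negligibleS (A := \bigcup_n H n)); last first.
    apply: negligible_bigcup => n; rewrite /H; case: (choice.unpickle n) => [q|].
      apply/negligibleP; first exact: measurableI.
      by apply/eqP; move/negP: (A0 q); rewrite measure_gt0 negbK.
    exact: negligible_set0.
  move=> x Dx; have [q gq] := repP (g x).
  by exists (choice.pickle q); [exact: Logic.I|rewrite /H (choice.pickleK q)].
have mDA : measurable (D `&` g @^-1` A q) by exact: measurableI.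
have [cI muI] := image_completed mDA.
have [E0 [mE0 E0sub _ nuE0]] := completed_inner cI.
(* G is measurable for the completed sigma-algebra only. Off the union NN of
   countably many null sets, one for each rational r, it is Borel. *)
have Scomp (r : rat) : exists BN : set R * set R,
    [/\ measurable BN.1, measurable BN.2, nu BN.2 = 0%E,
     BN.1 `<=` phi @` (X0 `&` g @^-1` [set t | t <= ratr r]) &
     phi @` (X0 `&` g @^-1` [set t | t <= ratr r]) `\` BN.1 `<=` BN.2].
  have [cS _] := image_completed (mg [set t | t <= ratr r]).
  have [B [mB Bsub [N [mN N0 SN]] _]] := completed_inner cS.
  by exists (B, N).
pose B r := (projT1 (cid (Scomp r))).1.
pose N r := (projT1 (cid (Scomp r))).2.
have BNP r : [/\ measurable (B r), measurable (N r), nu (N r) = 0%E,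
     B r `<=` phi @` (X0 `&` g @^-1` [set t | t <= ratr r]) &
     phi @` (X0 `&` g @^-1` [set t | t <= ratr r]) `\` B r `<=` N r].
  by rewrite /B /N; case: (cid (Scomp r)).
pose NN := \bigcup_n (if (choice.unpickle n : option rat) is Some r then N r else set0).
have mNN : measurable NN.
  apply: bigcupT_measurable => n; case: (choice.unpickle n) => // r.
  by have [] := BNP r.
have nuNN : nu NN = 0%E.
  apply: measure_negligible => //; apply: negligible_bigcup => n.
  case: (choice.unpickle n) => [r|]; last exact: negligible_set0.
  by have [_ ? ? _ _] := BNP r; exact/negligibleP.
pose E := E0 `&` `[0, 1]%classic `\` NN.
have mE : measurable E by apply: measurableD => //; exact: measurableI.
have lambdaE : lambda E = mu (D `&` g @^-1` A q).
  rewrite -(etrans nuE0 muI); apply/eqP; rewrite eq_le; apply/andP; split.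
    apply: (@le_measure _ _ _ lambda); [apply/mem_set; exact: mE| |by move=> y []].
    by apply/mem_set; exact: measurableI.
  rewrite -[leRHS]adde0 -nuNN.
  apply: (@le_trans _ _ (lambda (E `|` NN `&` `[0%R, 1%R]%classic))).
    apply: le_measure; [exact/mem_set/measurableI| |].
      by apply/mem_set; apply: measurableU => //; exact: measurableI.
    move=> y [E0y y01]; have [NNy|nNNy] := pselect (NN y); [right|left] => //.
  by apply: measureU2 => //; exact: measurableI.
have EsubA : E `<=` phi @` (X0 `&` (D `&` g @^-1` A q)).
  by move=> y [[/E0sub]].
have mG : measurable_fun E G.
  move=> mE'; apply: (measurability _ (RGenInftyO.measurableE R)) => // _ [_ [t ->] <-].
  rewrite (_ : E `&` _ = \bigcup_n (if (choice.unpickle n : option rat) is Some r then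
      if ratr r < t then E `&` B r else set0 else set0)).
    apply: bigcupT_measurable => n; case: (choice.unpickle n) => // r.
    by case: ifP => // _; apply: measurableI => //; have [] := BNP r.
  apply/seteqP; split => y.
    move=> [Ey]; rewrite /= in_itv /= => Gt.
    have [x [X0x _] xy] := EsubA _ Ey.
    rewrite -xy GE// in Gt; have [r] := rat_in_itvoo Gt.
    rewrite in_itv/= => /andP[gr rt].
    exists (choice.pickle r); first exact: Logic.I.
    rewrite (choice.pickleK r) rt; split => //; apply: contrapT => nB.
    have [_ _ _ _ SN] := BNP r.
    have [_] := Ey; apply; exists (choice.pickle r); first exact: Logic.I.
    rewrite (choice.pickleK r); apply: SN; split => //.
    by exists x => //; split => //; exact: ltW.
  move=> [n _]; case: (choice.unpickle n) => // r; case: ifP => // rt [Ey By]; split => //.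
  have [_ _ _ /(_ _ By)[x [X0x gx] xy] _] := BNP r.
  by rewrite /= in_itv/= -xy GE//; exact: le_lt_trans rt.
have finE : (lambda E < +oo)%E.
  rewrite lambdaE; apply: le_lt_trans (ltry 1); apply: le_trans mufin.
  by apply: le_measure => //; exact/mem_set.
have lambdaE0 : (0 < lambda E)%E by rewrite lambdaE.
have e0 : 0 < fine (lambda E) by rewrite fine_gt0// lambdaE0.
have [K [cK KE EK cG]] := measurable_almost_continuous mE finE e0 mG.
have mK : measurable K by exact: compact_measurable.
have lambdaK : (0 < lambda K)%E.
  rewrite measure_gt0; apply/eqP => K0.
  move: EK; rewrite fineK ?ge0_fin_numE// ltNge => /negP; apply.
  rewrite -[leRHS]add0e -K0.
  apply: (@le_trans _ _ (lambda (K `|` E `\` K))); last first.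
    by apply: measureU2 => //; exact: measurableD.
  apply: le_measure; [exact/mem_set| |].
    by apply/mem_set; apply: measurableU => //; exact: measurableD.
  by move=> y Ey; have [Ky|nKy] := pselect (K y); [left|right].
have cK' : compact (G @` K) by exact: continuous_compact.
(* The points of G @` K differ from their representatives by the same rational
   number q. *)
have K'0 : lambda (G @` K) = 0%E.
  apply: rational_transversal_null => // _ _ [y Ky <-] [z Kz <-] /rep_eq repyz.
  have [x [X0x [Dx Ax]] xy] := EsubA _ (KE _ Ky).
  have [x' [X0x' [Dx' Ax']] xz] := EsubA _ (KE _ Kz).
  rewrite -xy -xz !GE// in repyz *.
  have := Ax; rewrite /A /= repyz -[ratr q]Ax' /=; lra.
have := g_lambda (G @` K); rewrite K'0 leNgt => /negP; apply.
apply: lt_le_trans lambdaK _.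
have mDG : measurable (D `&` g @^-1` (G @` K)) by exact: measurableI.
have [_ <-] := image_completed mDG.
have -> : lambda K = nu K.
  rewrite /nu /mrestr setIidl// => y /KE [[_ ?] _] //.
have <- : nu^* K = nu K by exact: (@measurable_mu_extE _ _ _ (mrestr lambda (measurable_itv `[0%R, 1%R])) K mK).
apply: le_mu_ext => y Ky.
have [x [X0x [Dx _]] xy] := EsubA _ (KE _ Ky).
by exists x => //; split => //; split => //; exists y => //; rewrite -xy GE.
Qed.

End lebesgue_spaces.

(** * Approximation of Borel maps by simple maps *)

Section topological_groups.
Variable G : topologicalGroupType.

Lemma mulg_left_continuous (g : G) : continuous (fun x : G => (g * x)%g).
Proof. by move=> x; apply: mulg_cvg; [exact: cvg_cst|exact: cvg_id]. Qed.

Lemma nbhs_translate (g : G) (U : set G) : nbhs (1%g : G) U ->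
  nbhs g [set x | U (g^-1 * x)%g].
Proof.
move=> U1; apply: (@mulg_left_continuous g^-1%g g).
by rewrite mulVg.
Qed.

Lemma open_translate (g : G) (U : set G) : open U -> open [set x | U (g^-1 * x)%g].
Proof. by move=> oU; apply: open_comp => // x _; exact: mulg_left_continuous. Qed.

Lemma compact_translates (C U : set G) : compact C -> nbhs (1%g : G) U ->
  exists S : {fset G}, forall x, C x -> exists2 g, g \in S & U (g^-1 * x)%g.
Proof.
move=> /compact_near_coveringP cov U1.
(* The finite subsets of G, directed by inclusion. *)
pose F := filter_from [set: {fset G}] (fun S0 : {fset G} => [set S : {fset G} | (S0 `<=` S)%fset]).
have FF : Filter F.
  apply: filter_fromT_filter; first by exists fset0.
  move=> S T; exists (S `|` T)%fset => W /= STW.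
  by split; apply: fsubset_trans STW; [exact: fsubsetUl|exact: fsubsetUr].
have [|S0 _ S0P] := cov {fset G} F (fun S x => exists2 g, g \in S & U (g^-1 * x)%g) FF.
  move=> x _.
  exists ([set y | U (x^-1 * y)%g], [set S : {fset G} | ([fset x] `<=` S)%fset]).
    by split => /=; [exact: nbhs_translate|exists [fset x]%fset].
  by move=> [y S] /= [Uy xS]; exists x => //; rewrite -fsub1set.
exists S0 => x Cx; exact: (S0P S0 (fsubset_refl _) x Cx).
Qed.

(** The subgroup generated by a symmetric compact neighborhood C of 1: it is the
    union of the powers of C, and open because x C is a neighborhood of x. *)
Lemma sigma_compact_open_subgroup : hausdorff_space G -> locally_compact [set: G] ->
  exists P : nat -> set G, [/\ forall n, compact (P n),
    forall n x, P n x -> nbhs x (\bigcup_m P m),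
    (\bigcup_m P m) 1%g,
    (forall x y, (\bigcup_m P m) x -> (\bigcup_m P m) y -> (\bigcup_m P m) (x * y)%g)
    & (forall x, (\bigcup_m P m) x -> (\bigcup_m P m) (x^-1)%g)].
Proof.
move=> hG /(_ 1%g Logic.I)[U nU [cU clU]].
have {}nU : nbhs (1%g : G) U by apply: (@filterS _ (nbhs (1%g : G)) _ (fun x => [set: G] x -> U x)) nU => x; exact.
pose C := U `&` (fun x : G => x^-1%g) @^-1` U.
have cC : compact C.
  apply: (subclosed_compact _ cU); last by move=> x [].
  by apply: closedI => //; apply: preimage_closed => // x _; exact: invg_continuous.
have C1 : nbhs (1%g : G) C.
  by apply: filterI => //; apply: invg_continuous; rewrite invg1.
have CV x : C x -> C x^-1%g by move=> [Ux UVx]; split => //; rewrite /preimage /= invgK.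
pose step (P : set G) := (fun p : G * G => (p.1 * p.2)%g) @` (P `*` C).
pose P n := iter n step C.
have PS n x y : P n x -> C y -> P n.+1 (x * y)%g.
  by move=> Px Cy; exists (x, y).
have cP n : compact (P n).
  elim: n => //= n IHn; apply: continuous_compact; last exact: compact_setX.
  by apply: continuous_subspaceT; exact: mulg_continuous.
have PD m n x y : P m x -> P n y -> P (m + n).+1 (x * y)%g.
  elim: n y => [|n IHn] y Px; first by rewrite addn0 => Cy; exact: (PS _ _ _ Px Cy).
  move=> [[z c] /= [Pz Cc] <-]; rewrite /= addnS mulgA.
  exact: (PS _ _ _ (IHn _ Px Pz) Cc).
have PV n x : P n x -> (\bigcup_m P m) x^-1%g.
  elim: n x => [|n IHn] x; first by move=> /CV Cx; exists 0%N.
  move=> [[z c] /= [/IHn[m _ Pz] Cc] <-]; rewrite invgM.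
  by exists (0 + m).+1 => //; apply: PD => //; exact: CV.
exists P; split => //.
- move=> n x Px; apply: filterS (nbhs_translate x C1) => y Cy.
  by exists n.+1 => //; rewrite -(mulVKg x y); exact: PS.
- by exists 0%N => //; exact: nbhs_singleton.
- by move=> x y [m _ Px] [n _ Py]; exists (m + n).+1 => //; exact: PD.
- by move=> x [n _ Px]; exact: (PV n).
Qed.

End topological_groups.

Section tightness.
Local Open Scope measure_scope.
Variables (R : realType) (G : topologicalGroupType).
Variables (d : measure_display) (X : measurableType d).
Variable (mu : {measure set X -> \bar R}).
Hypothesis mufin : (mu setT <= 1)%E.

(** At most n + 1 fibers have a measure greater than 1 / (n + 1). *)
Lemma countable_positive_fibers (Y : choiceType) (f : X -> Y) :
  (forall B : set Y, measurable (f @^-1` B)) ->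
  countable [set y | (0 < mu (f @^-1` [set y]))%E].
Proof.
move=> mf.
rewrite (_ : [set y | _] =
    \bigcup_n [set y | (n.+1%:R^-1%:E < mu (f @^-1` [set y]))%E]); last first.
  apply/seteqP; split => y /=.
    move=> y0; have mfin : mu (f @^-1` [set y]) \is a fin_num.
      rewrite ge0_fin_numE//; apply: le_lt_trans (ltry 1); apply: le_trans mufin.
      by apply: le_measure => //; exact/mem_set.
    rewrite -(fineK mfin) lte_fin in y0.
    have [n] := ltr_add_invr y0; rewrite add0r => ny.
    by exists n => //=; rewrite -(fineK mfin) lte_fin.
  by move=> [n _ /=]; apply: lt_trans; rewrite lte_fin invr_gt0.
apply: bigcup_countable => // n _; apply: finite_set_countable.
apply: contrapT => /(infinite_set_fset n.+2)[S SP Sn].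
have : (mu (\big[setU/set0]_(y <- S) (f @^-1` [set y])) <= 1)%E.
  apply: le_trans mufin; apply: le_measure => //; apply/mem_set => //.
  by apply: bigsetU_measurable.
rewrite measure_fbigsetU//; last by apply/trivIsetP => i j _ _ ij; apply/seteqP; split => // x [/= -> /eqP]; rewrite (negbTE ij).
apply/negP; rewrite -ltNge.
apply: (@lt_le_trans _ _ (\sum_(y <- S) (n.+1%:R^-1)%:E)%E).
  rewrite sumEFin lte_fin big_const_seq count_predT iter_addr addr0.
  by rewrite -[ltRHS]mulr_natr mulrC ltr_pdivlMr// mul1r ltr_nat.
rewrite big_seq [leRHS]big_seq; apply: lee_sum => y yS; apply: ltW; exact: SP.
Qed.

(** The hypothesis on null fibers is applied to f modulo the subgroup H. The
    cosets that carry positive measure are countably many, and each of them is a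
    countable union of compact sets, so countably many translates of any
    neighborhood of 1 cover almost all values of f. *)
Lemma simple_map_approximation (f : X -> G) (V : set G) (e : R) :
  hausdorff_space G -> locally_compact [set: G] ->
  (forall (Y : Type) (f : X -> Y) (D : set X),
     (forall B : set Y, measurable (f @^-1` B)) -> measurable D ->
     (forall x, D x -> mu (f @^-1` [set f x]) = 0%E) -> mu D = 0%E) ->
  borel_measurable f -> nbhs (1%g : G) V -> 0 < e ->
  exists2 s : L0_map X G, simple_map s &
    (mu^* [set x | ~ V ((f x)^-1 * s x)%g] < e%:E)%E.
Proof.
move=> hG lG null_union mf V1 e0.
have [P [cP nP P1 PM PV]] := sigma_compact_open_subgroup hG lG.
set H := \bigcup_m P m in nP P1 PM PV.
pose cls (x : G) : set G := [set y | H (x^-1 * y)%g].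
have clsE x y : H (x^-1 * y)%g -> cls x = cls y.
  move=> xy; apply/seteqP; split => z; rewrite /cls /=.
    move=> xz; rewrite -(mulVKg x z) mulgA -[X in (X * _)%g](invgK) invgM invgK.
    by apply: PM => //; exact: PV.
  by move=> yz; rewrite -(mulVKg y z) mulgA; exact: PM.
have mF (B : set (set G)) : measurable ((cls \o f) @^-1` B).
  rewrite comp_preimage; apply: borel_measurable_preimage_open => //.
  rewrite openE => x Bx; have nH : nbhs (1%g : G) H.
    by have [m _ Pm] := P1; exact: nP Pm.
  by apply: filterS (nbhs_translate x nH) => y /clsE xy; rewrite /preimage /= -xy.
pose F := cls \o f; pose Pos := [set y | (0 < mu (F @^-1` [set y]))%E].
have cPos : countable Pos by exact: countable_positive_fibers.
have D0 : mu (F @^-1` ~` Pos) = 0%E.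
  apply: (null_union _ F) => // x nPos; apply/eqP; rewrite -[_ == _]negbK -measure_gt0.
  exact/negP.
pose U := [set v : G | V v^-1%g]°.
have U1 : nbhs (1%g : G) U.
  apply: nbhs_interior; apply: invg_continuous; by rewrite invg1.
have transl n := compact_translates (cP n) U1.
pose S n := projT1 (cid (transl n)).
have SP n x : P n x -> exists2 g, g \in S n & U (g^-1 * x)%g.
  by rewrite /S; case: (cid (transl n)) => S' /= S'P /S'P.
pose rep (y : set G) := xget 1%g y.
pose T := \bigcup_(y in Pos) \bigcup_n [set (rep y * g)%g | g in [set` S n]].
have /countable_injP[code code_inj] : countable T.
  apply: bigcup_countable => // y _; apply: bigcup_countable => // n _.
  by apply: finite_set_countable; exact: finite_image.
pose a n := xget 1%g [set t | T t /\ code t = n].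
have aP t : T t -> a (code t) = t.
  move=> Tt; have [Ta at_] : T (a (code t)) /\ code (a (code t)) = code t.
    by apply: (@xgetPex _ 1%g [set u | T u /\ code u = code t]); exists t.
  by apply: code_inj => //; exact/mem_set.
pose E n := f @^-1` [set z | U ((a n)^-1 * z)%g].
have mE n : measurable (E n).
  apply: borel_measurable_preimage_open => //; apply: open_translate.
  exact: open_interior.
have Ecover x : Pos (F x) -> exists n, E n x.
  move=> Fx; have : cls (f x) (rep (F x)).
    by apply: (@xgetPex _ 1%g (cls (f x))); exists (f x); rewrite /cls /= mulVg.
  move=> /PV; rewrite invgM invgK => -[n _ /SP[g gS Ug]].
  exists (code (rep (F x) * g)%g); rewrite /E /= aP; last first.
    by exists (F x) => //; exists n => //; exists g.
  by rewrite invgM -mulgA.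
pose W n := ~` \big[setU/set0]_(i < n) E i.
have mW n : measurable (W n) by apply: measurableC; exact: bigsetU_measurable.
have W0 : mu (\bigcap_n W n) = 0%E.
  apply/eqP; rewrite eq_le measure_ge0 andbT -D0; apply: le_measure.
  - by apply/mem_set; exact: bigcapT_measurable.
  - exact/mem_set.
  - move=> x xW Fx; have [n En] := Ecover x Fx.
    by apply: (xW n.+1 Logic.I); rewrite big_ord_recr /=; right.
have cW : mu (W n) @[n --> \oo] --> mu (\bigcap_n W n).
  apply: nonincreasing_cvg_mu => //.
  - apply: le_lt_trans (ltry 1); apply: le_trans mufin.
    by apply: le_measure => //; exact/mem_set.
  - exact: bigcapT_measurable.
  - move=> n m nm; apply/subsetPset; apply: subsetC; exact: subset_bigsetU.
rewrite W0 in cW.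
have [N WN] : exists N, (mu (W N) < e%:E)%E.
  apply: contrapT => /forallNP nW.
  suff : (e%:E <= 0)%E by rewrite lee_fin leNgt e0.
  rewrite -(cvg_lim _ cW)//; apply: lime_ge; first by apply/cvg_ex; exists 0%E.
  by apply: nearW => n; rewrite leNgt; apply/negP; exact: nW.
pose l x : {set 'I_N} := finset (fun i : 'I_N => `[< E i x >]).
have lE Q : l @^-1` [set Q] =
    \bigcap_(i in [set: 'I_N]) (if i \in Q then E i else ~` E i).
  apply/seteqP; split => x /=.
    move=> <- i _; case: ifP; rewrite inE => /asboolP //.
  move=> xQ; apply/setP => i; rewrite inE; have := xQ i Logic.I.
  by case: ifP => _ Ex; [exact/asboolP|apply/asboolP].
have ml : measurable_labels l.
  move=> Q; rewrite lE; apply: fin_bigcap_measurable => // i _.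
  by case: ifP => // _; exact: measurableC.
(* The translates may overlap: the label of x is the set of those that contain
   f x, and any of them will do. *)
pose c (Q : {set 'I_N}) : G := if [pick i in Q] is Some i then a i else 1%g.
exists (MkL0Map (labelled_carrier c ml)); first by exists {set 'I_N}, l, c.
apply: le_lt_trans WN; rewrite -(measurable_mu_extE mu (mW N)).
apply: le_mu_ext => x /= nV Wx; apply: nV; rewrite /c.
case: pickP => [i|none].
  rewrite inE => /asboolP; rewrite /E /= => /interior_subset /=.
  by rewrite invgM invgK.
exfalso; have [i Ei] : exists i : 'I_N, E i x.
  by move: Wx; rewrite -bigcup_mkord => -[i /= iN Ei]; exists (Ordinal iN).
by have /negP := negbT (none i); apply; rewrite inE; exact/asboolP.
Qed.

End tightness.

Theorem theorem2p2 (R : realType) (G : topologicalGroupType)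
    (d : measure_display) (X : measurableType d)
    (mu : {measure set X -> \bar R}) :
  hausdorff_space G -> locally_compact [set: G] -> amenable G R ->
  nonatomic_lebesgue_space mu ->
  extremely_amenable (L0 mu G).
Proof.
move=> hausG lcG /amenable_invariant_mean[M meanM].
move=> [X0 [Y0 [phi [nX0 nY0 phi_bij phiP]]]].
move=> K act hausK K0 compactK actP act_cont.
have mu1 : (mu setT <= 1)%E := lebesgue_space_le1 nX0 nY0 phi_bij phiP.
apply: (fixed_point_of_approximation mu1 _ meanM actP act_cont hausK K0 compactK).
  exact: (lebesgue_space_small_labels nX0 nY0 phi_bij phiP).
move=> f V e mf V1 e0; apply: simple_map_approximation => //.
exact: (null_fibers_union nX0 nY0 phi_bij phiP).
Qed.
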